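(* Let $\mathcal{G}=(V,\mathcal{E})$ be a hypergraph, $\mathcal{S}$ a family of subsets of $V$, $\alpha,\beta,\gamma\in\mathbb{Z}_+$, $f,g:V\to\mathbb{Z}_+$ functions, and $\mathsf{M}=(\mathcal{S},r_{\mathsf{M}})$ a matroid. One can add $\gamma$ edges to $\mathcal{G}$ (i.e. there is a set $F$ of $\gamma$ edges on $V$) so that $(V,\mathcal{E}\cup F)$ has an $\mathsf{M}$-based $(f,g)$-bounded $(\alpha,\beta)$-limited packing of rooted hyperforests if and only if all of the following hold: (i) $\alpha\le\beta$; (ii) $r_{\mathsf{M}}(\mathcal{S})-r_{\mathsf{M}}(\mathcal{S}_Y)\le\min\{\beta-f(Y),g(V\setminus Y)\}$ for every $Y\subseteq V$; (iii) $f(v)\le\min\{r_{\mathsf{M}}(\mathcal{S}_v),g(v)\}$ for every $v\in V$; (iv) $\alpha\le\sum_{v\in V}\min\{r_{\mathsf{M}}(\mathcal{S}_v),g(v)\}$; (v) $g(V)+\gamma+e_{\mathcal{E}}(\mathcal{P})\ge\sum_{X\in\mathcal{P}}\max\{r_{\mathsf{M}}(\mathcal{S})-r_{\mathsf{M}}(\mathcal{S}_Y)+g(Y):Y\subseteq X\}$ for every partition $\mathcal{P}$ of $V$; (vi) $\beta+\gamma+e_{\mathcal{E}}(\mathcal{P})\ge\sum_{X\in\mathcal{P}}\max\{r_{\mathsf{M}}(\mathcal{S})-r_{\mathsf{M}}(\mathcal{S}_Y)+f(Y):Y\subseteq X\}$ for every partition $\mathcal{P}$ of $V$.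
   Context: A family $\mathcal{S}$ of subsets of $V$ allows multiplicities and is the ground set of $\mathsf{M}$; for $X\subseteq V$, $\mathcal{S}_X$ is the subfamily of members of $\mathcal{S}$ intersecting $X$, and $\mathcal{S}_v=\mathcal{S}_{\{v\}}$; $r_{\mathsf{M}}$ is the rank function of $\mathsf{M}$. $\mathbb{Z}_+$ is the non-negative integers; $h(X)=\sum_{x\in X}h(x)$. Edges are pairs of distinct vertices; hyperedges are subsets of $V$ of size at least two; $e_{\mathcal{E}}(\mathcal{P})$ is the number of hyperedges of $\mathcal{E}$ not contained in a single member of the partition $\mathcal{P}$. Trimming a hyperedge $Z$ replaces it by an edge with both end-vertices in $Z$. A rooted forest in a graph is a pair $(R,F)$ with $F$ a forest and $R$ a set containing exactly one vertex of each connected component of $F$. A pair $(R,\mathcal{F})$ with $\mathcal{F}$ a set of hyperedges is a rooted hyperforest if $\mathcal{F}$ can be trimmed to a forest $F$ such that, for the graph $F'$ obtained from $F$ by deleting isolated vertices not in $R$, $(R,F')$ is a rooted forest. A set of rooted hyperforests is a packing if it can be trimmed (hyperedge sets used disjointly) to a set of pairwise edge-disjoint rooted forests. Such a packing is $\mathsf{M}$-based if for every $S\in\mathcal{S}$ there is $S'\subseteq S$ such that $\{S':S\in\mathcal{S}\}$ is the set of root sets of the rooted forests of the trimmed packing and, for every vertex $v$, $\{S\in\mathcal{S}: \text{the rooted forest with root set } S' \text{ contains } v\}$ is a basis of $\mathsf{M}$. It is $(f,g)$-bounded if every vertex $v$ is a root in at least $f(v)$ and at most $g(v)$ of the rooted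 forests, and $(\alpha,\beta)$-limited if the total number of roots over all rooted forests is at least $\alpha$ and at most $\beta$.
   Formalization: V is assumed nonempty and, if γ>0, to have at least two vertices (the equivalence fails otherwise); the γ added edges may be parallel to each other or to members of E, and root sets are counted with multiplicity, one rooted forest (possibly empty) per member of the family S. *)

(* Defs.v *)
From HB Require Import structures.
From mathcomp Require Import all_boot all_order all_algebra.

Set Implicit Arguments.
Unset Strict Implicit.
Unset Printing Implicit Defensive.

Record matroid (T : finType) := Matroid {
  mrank :> {set T} -> nat;
  mrank_card : forall A : {set T}, mrank A <= #|A|;
  mrankS : forall A B : {set T}, A \subset B -> mrank A <= mrank B;
  mrank_submod : forall A B : {set T},
    mrank (A :|: B) + mrank (A :&: B) <= mrank A + mrank B }.

Definition indep (T : finType) (M : matroid T) : pred {set T} :=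
  fun A => mrank M A == #|A|.

Definition basis (T : finType) (M : matroid T) (B : {set T}) : bool :=
  maxset (indep M) B.

Definition fsum (V : finType) (h : V -> nat) (X : {set V}) : nat :=
  \sum_(x in X) h x.

(* A family of subsets of V with multiplicities is an indexed family S : I -> {set V};
   its subfamilies, and the ground set of a matroid on it, are sets of indices. *)
Definition meeting (V I : finType) (S : I -> {set V}) (X : {set V}) : {set I} :=
  [set i | S i :&: X != set0].

(* Hyperedges are indexed, so that parallel hyperedges are allowed. *)
Record hypergraph (V : finType) := Hypergraph {
  hedge : finType;
  hverts : hedge -> {set V};
  hverts_card : forall e, 1 < #|hverts e| }.

Definition edge (V : finType) : finType := {e : {set V} | #|e| == 2}.

Definition add_verts (V : finType) (G : hypergraph V) (n : nat) (F : 'I_n -> edge V)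
    (e : hedge G + 'I_n) : {set V} :=
  match e with inl e => hverts e | inr j => val (F j) end.

Lemma add_verts_card (V : finType) (G : hypergraph V) (n : nat) (F : 'I_n -> edge V)
    (e : hedge G + 'I_n) : 1 < #|add_verts F e|.
Proof. by case: e => [e|j] /=; [exact: hverts_card | rewrite (eqP (valP (F j)))]. Qed.

Definition add_edges (V : finType) (G : hypergraph V) (n : nat) (F : 'I_n -> edge V) :
    hypergraph V :=
  Hypergraph (@add_verts_card V G n F).

Definition crossing (V : finType) (G : hypergraph V) (P : {set {set V}}) : nat :=
  #|[set e : hedge G | ~~ [exists X in P, hverts e \subset X]]|.

(* Multigraphs with vertices in V and edge names in E; gends is only relevant on gedges. *)
Record graph (V E : finType) := Graph {
  gverts : {set V};
  gedges : {set E};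
  gends : E -> {set V} }.

Definition is_graph (V E : finType) (D : graph V E) : Prop :=
  forall e, e \in gedges D -> #|gends D e| = 2 /\ gends D e \subset gverts D.

(* The sequence (v_1, e_1), ..., (v_k, e_k) stands for the cycle v_1 e_1 v_2 ... v_k e_k v_1;
   a pair of parallel edges gives a cycle with k = 2. *)
Definition graph_cycle (V E : finType) (D : graph V E) (c : seq (V * E)) : bool :=
  [&& c != [::],
      all (fun p => p.2 \in gedges D) c,
      uniq (unzip1 c), uniq (unzip2 c)
    & cycle (fun p q => gends D p.2 == [set p.1; q.1]) c].

Definition forest (V E : finType) (D : graph V E) : Prop :=
  is_graph D /\ forall c, ~~ graph_cycle D c.

Definition adjacent (V E : finType) (D : graph V E) : rel V :=
  fun x y => [exists e in gedges D, gends D e == [set x; y]].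

Definition components (V E : finType) (D : graph V E) : {set {set V}} :=
  equivalence_partition (connect (adjacent D)) (gverts D).

Definition rooted_forest (V E : finType) (R : {set V}) (D : graph V E) : Prop :=
  [/\ forest D, R \subset gverts D
    & forall C, C \in components D -> #|R :&: C| = 1].

Definition drop_isolated (V E : finType) (R : {set V}) (D : graph V E) : graph V E :=
  Graph [set v in gverts D | (v \in R) || [exists e in gedges D, v \in gends D e]]
        (gedges D) (gends D).

Definition trims (V : finType) (G : hypergraph V) (A : {set hedge G})
    (t : hedge G -> {set V}) : Prop :=
  forall e, e \in A -> #|t e| = 2 /\ t e \subset hverts e.

Definition trimmed (V : finType) (G : hypergraph V) (A : {set hedge G})
    (t : hedge G -> {set V}) : graph V (hedge G) :=
  Graph [set: V] A t.

(* For H = (R, A) : the rooted forest is R together with trimmed_forest H t. *)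
Definition trimmed_forest (V : finType) (G : hypergraph V)
    (H : {set V} * {set hedge G}) (t : hedge G -> {set V}) : graph V (hedge G) :=
  drop_isolated H.1 (trimmed H.2 t).

Definition trims_rooted (V : finType) (G : hypergraph V)
    (H : {set V} * {set hedge G}) (t : hedge G -> {set V}) : Prop :=
  [/\ trims H.2 t, forest (trimmed H.2 t) & rooted_forest H.1 (trimmed_forest H t)].

Definition rooted_hyperforest (V : finType) (G : hypergraph V)
    (H : {set V} * {set hedge G}) : Prop :=
  exists t, trims_rooted H t.

(* Since the hyperedge sets are pairwise disjoint, one map t trims them all. *)
Definition trims_packing (V : finType) (G : hypergraph V) (K : finType)
    (P : K -> {set V} * {set hedge G}) (t : hedge G -> {set V}) : Prop :=
  (forall k l, k != l -> [disjoint (P k).2 & (P l).2]) /\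
  (forall k, trims_rooted (P k) t).

Definition packing (V : finType) (G : hypergraph V) (K : finType)
    (P : K -> {set V} * {set hedge G}) : Prop :=
  (forall k, rooted_hyperforest (P k)) /\ exists t, trims_packing P t.

(* The root sets S' i (i : I) are those of the packing as a family, with multiplicities:
   sigma tells which rooted forest has been assigned to each member of S. *)
Definition matroid_based (V : finType) (G : hypergraph V) (I : finType)
    (S : I -> {set V}) (M : matroid I) (K : finType)
    (P : K -> {set V} * {set hedge G}) : Prop :=
  exists (t : hedge G -> {set V}) (S' : I -> {set V}) (sigma : I -> K),
    [/\ trims_packing P t,
        forall i, S' i \subset S i,
        bijective sigma,
        forall i, (P (sigma i)).1 = S' i
      & forall v, basis M [set i | v \in gverts (trimmed_forest (P (sigma i)) t)]].

Definition bounded (V : finType) (G : hypergraph V) (K : finType) (f g : V -> nat)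
    (P : K -> {set V} * {set hedge G}) : Prop :=
  forall v, f v <= #|[set k | v \in (P k).1]| <= g v.

Definition limited (V : finType) (G : hypergraph V) (K : finType) (alpha beta : nat)
    (P : K -> {set V} * {set hedge G}) : Prop :=
  alpha <= \sum_k #|(P k).1| <= beta.

(* r(S) - r(S_Y); the truncated subtraction is exact by monotonicity of the rank. *)
Definition rank_deficit (V I : finType) (S : I -> {set V}) (M : matroid I) (Y : {set V}) : nat :=
  mrank M [set: I] - mrank M (meeting S Y).

(* Main.v *)
Require Import Defs.
From mathcomp Require Import all_boot all_order all_algebra.
From mathcomp Require Import zify.

Set Implicit Arguments.
Unset Strict Implicit.
Unset Printing Implicit Defensive.

(* Let k be the rank of M and represent each of the gamma new edges by a hyperedge V,
   to be trimmed later. An M-based packing is an orientation (a head for each hyperedge)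
   together with sets T_v of roots such that rho(X) + r(T_X) >= k for all nonempty X: given
   these, hyperedges are trimmed to arcs and the root sets grown along them one by one, an
   obstruction to every step being excluded by uncrossing tight sets.

   For sufficiency one first looks for the vectors t(v) = |T_v| and d(v) = in-degree of v.
   They must satisfy k + i(X) <= r(S_Y) + t(X \ Y) + d(X) for all Y <= X <> 0, where i(X) is
   the number of hyperedges inside X. Tight pairs (X, Y) can be uncrossed, and a vector
   admitting no improving move has a partition of V into tight pairs, which is compared with
   (v) or (vi): from t = f and d large, lowering d gives t(V) + d(V) <= beta + |E| by (vi);
   exchanging units of d for units of t <= g then gives d(V) <= |E| by (v). Vectors t and d
   are realised by actual roots and heads one unit at a time, again by uncrossing.

   For necessity, each i in a basis at a vertex of X but without a root in X has an edge
   entering X, found at a vertex of X nearest to the roots; these edges cross the partition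
   and are distinct. *)

(** * Sums of vertex weights over sets *)

Section SetSums.
Variable V : finType.
Implicit Types (h : V -> nat) (X Y : {set V}) (v : V).

Definition incr h v : V -> nat := fun w => h w + (w == v).
Definition decr h v : V -> nat := fun w => h w - (w == v).

Lemma fsumE h X : fsum h X = \sum_v (v \in X) * h v.
Proof. by rewrite /fsum big_mkcond; apply: eq_bigr => v _; case: ifP; lia. Qed.

Lemma fsum_indicator v X : \sum_w (w \in X) * (w == v) = (v \in X).
Proof.
rewrite (bigD1 v) //= big1 => [|w /negPf->]; last by rewrite muln0.
by rewrite eqxx muln1 addn0.
Qed.

Lemma fsum_incr h v X : fsum (incr h v) X = fsum h X + (v \in X).
Proof.
by rewrite !fsumE -(fsum_indicator v X) -big_split; apply: eq_bigr => w _ /=; rewrite -mulnDr.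
Qed.

Lemma fsum_decr h v X : 0 < h v -> fsum (decr h v) X + (v \in X) = fsum h X.
Proof.
move=> hv; rewrite !fsumE -(fsum_indicator v X) -big_split; apply: eq_bigr => w _ /=.
by rewrite /decr; case: eqP => [->|] /=; nia.
Qed.

Lemma fsumS h X Y : X \subset Y -> fsum h X <= fsum h Y.
Proof.
move=> sXY; rewrite !fsumE; apply: leq_sum => v _; rewrite leq_mul2r.
by have := subsetP sXY v; case: (v \in X) => [->|] //; rewrite ?leqnn ?orbT.
Qed.

Lemma leq_fsum h1 h2 X : (forall v, h1 v <= h2 v) -> fsum h1 X <= fsum h2 X.
Proof. by move=> le; apply: leq_sum. Qed.

Lemma fsumT h : fsum h [set: V] = \sum_v h v.
Proof. by apply: eq_bigl => v; rewrite inE. Qed.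

Lemma fsum0 h : fsum h set0 = 0.
Proof. by rewrite /fsum big_set0. Qed.

Lemma fsum1 h v : fsum h [set v] = h v.
Proof. by rewrite /fsum big_set1. Qed.

Lemma fsumUI h X Y : fsum h (X :|: Y) + fsum h (X :&: Y) = fsum h X + fsum h Y.
Proof.
rewrite !fsumE -!big_split; apply: eq_bigr => v _ /=.
by rewrite !inE; case: (v \in X); case: (v \in Y) => /=; lia.
Qed.

Lemma fsumD h X Y : Y \subset X -> fsum h (X :\: Y) + fsum h Y = fsum h X.
Proof.
move=> /subsetP sYX; rewrite !fsumE -big_split; apply: eq_bigr => v _ /=.
by have := sYX v; rewrite !inE; case: (v \in Y) => [->|_] //=; rewrite ?addn0.
Qed.

Lemma fsum_diffUI h (X1 Y1 X2 Y2 : {set V}) : Y1 \subset X1 -> Y2 \subset X2 ->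
  fsum h ((X1 :|: X2) :\: (Y1 :|: Y2)) + fsum h ((X1 :&: X2) :\: (Y1 :&: Y2))
  = fsum h (X1 :\: Y1) + fsum h (X2 :\: Y2).
Proof.
move=> s1 s2; have := fsumD h s1; have := fsumD h s2.
have := fsumD h (setUSS s1 s2); have := fsumD h (setISS s1 s2).
have := fsumUI h X1 X2; have := fsumUI h Y1 Y2; clear; lia.
Qed.
End SetSums.

(** * Covering vectors and the uncrossing of tight pairs *)

Section Covers.
Variables (V : finType) (k : nat) (a b : {set V} -> nat).
Implicit Types (t d G : V -> nat) (X Y : {set V}) (v : V).

(** [a X] abstracts the number of hyperedges inside [X], and [b Y] the rank of the subfamily meeting
    [Y]. *)
Definition covers t d : bool :=
  [forall X : {set V}, [forall Y : {set V}, (Y \subset X) && (X != set0) ==>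
     (k + a X <= b Y + fsum t (X :\: Y) + fsum d X)]].

Lemma coversP t d :
  reflect (forall X Y, Y \subset X -> X != set0 ->
             k + a X <= b Y + fsum t (X :\: Y) + fsum d X)
          (covers t d).
Proof.
apply: (iffP forallP) => [H X Y sYX X0|H X].
  by have /forallP/(_ Y) := H X; rewrite sYX X0.
by apply/forallP => Y; apply/implyP => /andP[sYX X0]; apply: H.
Qed.

Lemma coversPn t d :
  ~~ covers t d -> exists X Y, [/\ Y \subset X, X != set0 &
             b Y + fsum t (X :\: Y) + fsum d X < k + a X].
Proof.
rewrite negb_forall => /existsP[X]; rewrite negb_forall => /existsP[Y].
by rewrite negb_imply -ltnNge => /andP[/andP[sYX X0] lt]; exists X, Y.
Qed.

Lemma covers_mono t d t' d' : (forall v, t v <= t' v) -> (forall v, d v <= d' v) ->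
  covers t d -> covers t' d'.
Proof.
move=> let' led /coversP C; apply/coversP => X Y sYX X0.
have := C X Y sYX X0; have := leq_fsum (X :\: Y) let'; have := leq_fsum X led; lia.
Qed.

Definition tight t d (p : {set V} * {set V}) : bool :=
  [&& p.2 \subset p.1, p.1 != set0
    & k + a p.1 == b p.2 + fsum t (p.1 :\: p.2) + fsum d p.1].

Hypothesis a_supmod : forall X Y, X :&: Y != set0 ->
  a X + a Y <= a (X :|: Y) + a (X :&: Y).
Hypothesis b_submod : forall X Y, b (X :|: Y) + b (X :&: Y) <= b X + b Y.
Hypothesis b_le : forall X, b X <= k.

(** The terms in [t] and [d] are modular, [a] is supermodular and [b] submodular, which forces
    equality in the covering inequalities at the union and at the intersection. *)
Lemma tight_join t d p q : covers t d -> tight t d p -> tight t d q ->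
  p.1 :&: q.1 != set0 -> tight t d (p.1 :|: q.1, p.2 :|: q.2).
Proof.
case: p q => [X1 Y1] [X2 Y2] /coversP C; rewrite /tight /=.
move=> /and3P[s1 X10 /eqP e1] /and3P[s2 X20 /eqP e2] X120.
have sU : Y1 :|: Y2 \subset X1 :|: X2 by rewrite setUSS.
have U0 : X1 :|: X2 != set0.
  by apply: contraNneq X10 => U; rewrite -subset0 -U subsetUl.
have := C _ _ sU U0; have := C (X1 :&: X2) (Y1 :&: Y2) (setISS s1 s2) X120.
have := a_supmod X120; have := b_submod Y1 Y2; rewrite sU U0 /=.
have := fsumUI d X1 X2; have := fsum_diffUI t s1 s2; move: e1 e2; clear; lia.
Qed.

(** If [d v = 0], then [([set v], [set v])] is tight because [b] is at most [k]. Otherwise a pair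
    violated after a failed move was tight before it and has [v] in its first component; raising
    [t v] makes up for lowering [d v] unless [v] is in the second component too. *)
Lemma local_tight t d G : (forall v, t v <= G v) -> covers t d ->
  (forall v, 0 < d v -> ~~ covers t (decr d v)) ->
  (forall v, 0 < d v -> t v < G v -> ~~ covers (incr t v) (decr d v)) ->
  forall v, exists p, [/\ tight t d p, v \in p.1 & t v < G v -> v \in p.2].
Proof.
move=> tG /[dup] Cb /coversP C Nd Nt v; case: (posnP (d v)) => [d0|dpos].
  exists ([set v], [set v]); rewrite /tight /= subxx inE eqxx; split=> //.
  have n0 : [set v] != set0 by apply/set0Pn; exists v; rewrite inE.
  have := C [set v] [set v] (subxx _) n0; have := b_le [set v].
  by rewrite n0 setDv fsum0 fsum1 d0 /=; lia.
case: (ltnP (t v) (G v)) => tv.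
  have [X [Y [sYX X0]]] := coversPn (Nt v dpos tv).
  have := C X Y sYX X0; have := fsum_decr X dpos; rewrite fsum_incr !inE.
  move=> e1 le lt; exists (X, Y); rewrite /tight /= sYX X0 /=.
  have sY := subsetP sYX v; move: sY e1 lt le.
  by case: (v \in Y) => [->|_] //=; case: (v \in X) => //=; split=> //; lia.
have [X [Y [sYX X0]]] := coversPn (Nd v dpos).
have := C X Y sYX X0; have := fsum_decr X dpos.
move=> e1 le lt; exists (X, Y); rewrite /tight /= sYX X0 /=.
by move: e1 lt le; case: (v \in X) => //=; split=> //; lia.
Qed.

(* Tight pairs whose first components meet can be joined, so the maximal ones partition V. *)
Lemma tight_partition t d (L : pred V) : covers t d ->
  (forall v, exists p, [/\ tight t d p, v \in p.1 & L v -> v \in p.2]) ->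
  exists (P : {set {set V}}) (Y : {set V} -> {set V}),
    [/\ partition P [set: V], forall X, X \in P -> tight t d (X, Y X)
      & forall X v, X \in P -> v \in X -> L v -> v \in Y X].
Proof.
move=> C ex.
have: forall v, exists p, [/\ tight t d p, v \in p.1 &
    forall q, tight t d q -> p.1 :&: q.1 != set0 -> (q.1 \subset p.1) && (q.2 \subset p.2)].
  move=> v; have [p0 [tp0 vp0 _]] := ex v.
  pose Q (p : {set V} * {set V}) := tight t d p && (v \in p.1).
  have Qp0 : Q p0 by rewrite /Q tp0.
  (* Maximising both cardinalities together makes the join with any tight pair that meets it leave
     the pair unchanged. *)
  pose F (p : {set V} * {set V}) := #|p.1| + #|p.2|.
  case: (@arg_maxnP _ p0 Q F Qp0) => -[X Y] /andP[tp /= vX] mx.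
  exists (X, Y); split=> // -[X' Y'] tq /= XX'.
  have := mx (X :|: X', Y :|: Y'); rewrite /Q (tight_join C tp tq) //= inE vX => /(_ isT).
  rewrite /F /geq /= => le.
  have := subset_leq_card (subsetUl X X'); have := subset_leq_card (subsetUl Y Y') => l2 l1.
  have /eqP e1 : X == X :|: X' by rewrite eqEcard subsetUl; lia.
  have /eqP e2 : Y == Y :|: Y' by rewrite eqEcard subsetUl; lia.
  by rewrite e1 e2 !subsetUr.
move=> /fin_all_exists[m Hm].
have mm u v w : w \in (m u).1 -> w \in (m v).1 -> m u = m v.
  move=> wu wv; have [tu _ mu] := Hm u; have [tv _ mv] := Hm v.
  have n0 : (m u).1 :&: (m v).1 != set0 by apply/set0Pn; exists w; rewrite inE wu.
  have /andP[s1 s2] := mu _ tv n0; rewrite setIC in n0; have /andP[s3 s4] := mv _ tu n0.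
  rewrite [LHS]surjective_pairing [RHS]surjective_pairing.
  by congr pair; apply/eqP; rewrite eqEsubset ?s1 ?s2 ?s3 ?s4.
(* Any vertex of a block recovers its pair, by [mm]; the default [set0] is never reached on
   blocks. *)
pose Y X := if [pick v in X] is Some v then (m v).2 else set0.
have YE v : Y (m v).1 = (m v).2.
  rewrite /Y; case: pickP => [w wv|/(_ v)]; last by have [_ -> ] := Hm v.
  by have [_ ww _] := Hm w; rewrite (mm w v w).
exists [set (m v).1 | v : V], Y; split.
- apply/and3P; split.
  + rewrite eqEsubset subsetT; apply/subsetP => v _; apply/bigcupP.
    by exists (m v).1; [exact: imset_f | have [] := Hm v].
  + apply/trivIsetP => _ _ /imsetP[u _ ->] /imsetP[v _ ->]; apply: contraNT.
    by rewrite -setI_eq0 => /set0Pn[w]; rewrite inE => /andP[wu wv]; rewrite (mm u v w).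
  + apply/imsetP => -[v _ e]; have [_ ] := Hm v; by rewrite -e inE.
- by move=> _ /imsetP[v _ ->]; rewrite YE -surjective_pairing; have [] := Hm v.
move=> _ w /imsetP[v _ ->] wv Lw; rewrite YE.
have [q [tq wq /(_ Lw) wq2]] := ex w; have [_ _ /(_ q tq)] := Hm v.
have n0 : (m v).1 :&: q.1 != set0 by apply/set0Pn; exists w; rewrite inE wv.
by move=> /(_ n0) /andP[_ /subsetP/(_ _ wq2)].
Qed.

Lemma fsum_partition (h : V -> nat) (P : {set {set V}}) :
  partition P [set: V] -> \sum_(X in P) fsum h X = fsum h [set: V].
Proof.
by case/and3P => /eqP cP tI _; rewrite /fsum -big_trivIset // cP.
Qed.

(** The moves lower [d v] by one, or trade a unit of [d v] for a unit of [t v] below the cap [G v];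
    both decrease the total of [d]. When no move is left, tight pairs partition [V], and their
    equalities add up to the last statement. *)
Lemma covers_exchange t0 d0 G : (forall v, t0 v <= G v) -> covers t0 d0 ->
  exists t d (P : {set {set V}}) (Y : {set V} -> {set V}),
    [/\ covers t d, forall v, t0 v <= t v <= G v,
        fsum t [set: V] + fsum d [set: V] <= fsum t0 [set: V] + fsum d0 [set: V],
        partition P [set: V] /\ (forall X, X \in P -> Y X \subset X)
      & \sum_(X in P) (k + a X)
        = \sum_(X in P) (b (Y X) + fsum G (X :\: Y X)) + fsum d [set: V]].
Proof.
have [n] := ubnP (fsum d0 [set: V]).
elim: n t0 d0 => // n IHn t0 d0 /ltnSE len tG C.
case: (boolP [exists v, (0 < d0 v) && covers t0 (decr d0 v)]) => [|no1].
  case/existsP => v /andP[dv C']; have := fsum_decr [set: V] dv; rewrite inE => e.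
  have lt : fsum (decr d0 v) [set: V] < n by lia.
  have [t [d [P [Y [C1 b1 s1 PP E]]]]] := IHn _ _ lt tG C'.
  by exists t, d, P, Y; split=> //; lia.
case: (boolP [exists v, [&& 0 < d0 v, t0 v < G v & covers (incr t0 v) (decr d0 v)]]) => [|no2].
  case/existsP => v /and3P[dv tv C']; have := fsum_decr [set: V] dv; rewrite inE => e.
  have lt : fsum (decr d0 v) [set: V] < n by lia.
  have tG' w : incr t0 v w <= G w.
    by have := tG w; rewrite /incr; case: eqP => [->|_]; lia.
  have [t [d [P [Y [C1 b1 s1 PP E]]]]] := IHn _ _ lt tG' C'.
  move: s1; rewrite fsum_incr inE => s1.
  exists t, d, P, Y; split=> //; last by lia.
  by move=> w; have := b1 w; rewrite /incr; lia.
have lt := @local_tight t0 d0 G tG C.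
have Nd v : 0 < d0 v -> ~~ covers t0 (decr d0 v).
  by move=> dv; move/existsPn/(_ v): no1; rewrite dv.
have Nt v : 0 < d0 v -> t0 v < G v -> ~~ covers (incr t0 v) (decr d0 v).
  by move=> dv tv; move/existsPn/(_ v): no2; rewrite dv tv.
have [P [Y [PP tP LY]]] := tight_partition (L := fun v => t0 v < G v) C (lt Nd Nt).
exists t0, d0, P, Y; split=> //.
- by move=> v; rewrite leqnn tG.
- by split=> // X XP; have /and3P[] := tP X XP.
rewrite -(fsum_partition d0 PP) -big_split; apply: eq_bigr => X XP /=.
have /and3P[_ _ /eqP ->] := tP X XP; congr (_ + _ + _).
(* A vertex of [X] outside [Y X] is saturated, so [G] may replace [t0] there. *)
apply: eq_bigr => v; rewrite inE => /andP[vY vX]; apply/eqP; rewrite eqn_leq tG leqNgt.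
by apply: contra vY; apply: LY.
Qed.

End Covers.

(** * Matroid rank, independent sets and bases *)

Section Rank.
Variables (I : finType) (M : matroid I).
Implicit Types (A B T : {set I}) (i : I).

Lemma mrankU1 i A : mrank M (i |: A) <= (mrank M A).+1.
Proof.
by have := mrank_submod M [set i] A; have := mrank_card M [set i]; rewrite cards1; lia.
Qed.

(** The equality [mrank M (i |: A) = mrank M A] expresses that [A] spans [i]; submodularity passes
    it on to supersets. *)
Lemma mrank_span i A B : A \subset B -> mrank M (i |: A) = mrank M A ->
  mrank M (i |: B) = mrank M B.
Proof.
move=> sAB e; apply/eqP; rewrite eqn_leq [X in _ && X]mrankS ?subsetUr // andbT.
have := mrank_submod M (i |: A) B; rewrite -setUA (setUidPr sAB) e.
have sA : A \subset (i |: A) :&: B by rewrite subsetI subsetUr.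
by have := mrankS M sA; lia.
Qed.

Lemma mrank_spanU A B : (forall i, i \in B -> mrank M (i |: A) = mrank M A) ->
  mrank M (A :|: B) = mrank M A.
Proof.
have [n] := ubnP #|B|; elim: n B => // n IHn B /ltnSE leB H.
have [->|[i iB]] := set_0Vmem B; first by rewrite setU0.
have -> : A :|: B = i |: (A :|: B :\ i) by rewrite setUCA setD1K.
have H' j : j \in B :\ i -> mrank M (j |: A) = mrank M A.
  by rewrite inE => /andP[_]; apply: H.
have IH : mrank M (A :|: B :\ i) = mrank M A.
  by apply: IHn => //; have := cardsD1 i B; rewrite iB; lia.
by rewrite (@mrank_span i A) ?subsetUl ?H.
Qed.

Lemma mrank_augment T A : mrank M T < mrank M A ->
  exists2 i, i \in A & mrank M (i |: T) = (mrank M T).+1.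
Proof.
move=> lt; case: (boolP [exists i in A, mrank M (i |: T) != mrank M T]).
  case/existsP => i /andP[iA ne]; exists i => //.
  by have := mrankU1 i T; have := mrankS M (subsetUr [set i] T); lia.
rewrite negb_exists => /forallP H.
have e : mrank M (T :|: A) = mrank M T.
  by apply: mrank_spanU => i iA; have := H i; rewrite iA /= negbK => /eqP.
by have := mrankS M (subsetUr T A); lia.
Qed.

Lemma indep_extend T A m : indep M T -> T \subset A -> #|T| <= m <= mrank M A ->
  exists T', [/\ T \subset T', T' \subset A, indep M T' & #|T'| = m].
Proof.
have [n] := ubnP (m - #|T|); elim: n T => // n IHn T /ltnSE len iT sTA /andP[le1 le2].
move: (iT); rewrite /indep => /eqP eT.
case: (ltnP #|T| m) => [lt|ge]; last by exists T; split=> //; lia.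
have [|i iA ei] := @mrank_augment T A; first by lia.
have iNT : i \notin T.
  by apply/negP => iT'; move: ei; rewrite (setUidPr _) ?sub1set //; lia.
have c : #|i |: T| = #|T|.+1 by rewrite cardsU1 iNT.
have [||||T' [s1 s2 iT' cT']] := IHn (i |: T).
- by rewrite c; lia.
- by rewrite /indep c ei eT.
- by rewrite subUset sub1set iA.
- by rewrite c lt le2.
- by exists T'; split=> //; apply: subset_trans s1; apply: subsetUr.
Qed.

Lemma indep0 : indep M set0.
Proof. by rewrite /indep; have := mrank_card M set0; rewrite cards0 leqn0. Qed.

Lemma indep_base A : exists T, [/\ T \subset A, indep M T & mrank M T = mrank M A].
Proof.
have [|T [_ sTA iT c]] := @indep_extend set0 A (mrank M A) indep0 (sub0set _).
  by rewrite cards0 leqnn.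
by exists T; split=> //; move: iT; rewrite /indep c => /eqP.
Qed.

Lemma basisP B : reflect (indep M B /\ #|B| = mrank M [set: I]) (basis M B).
Proof.
apply: (iffP maxsetP) => -[iB].
  move=> mB; split=> //; move: (iB) => /eqP eB.
  have [|T [sBT _ iT cT]] := @indep_extend B [set: I] (mrank M [set: I]) iB (subsetT _).
    by rewrite leqnn andbT -eB mrankS ?subsetT.
  by rewrite -cT (mB T iT sBT).
move=> cB; split=> // B' iB' sBB'; apply/eqP; rewrite eq_sym eqEcard sBB'.
by move: iB' => /eqP <-; rewrite cB mrankS ?subsetT.
Qed.

(** Used to shrink root sets to independent ones without losing rank on any vertex set. *)
Lemma mrank_bigcup_span (V : finType) (T T' : V -> {set I}) (X : {set V}) :
  (forall v, T' v \subset T v) -> (forall v, mrank M (T' v) = mrank M (T v)) ->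
  mrank M (\bigcup_(v in X) T' v) = mrank M (\bigcup_(v in X) T v).
Proof.
move=> sT eT; set A := \bigcup_(v in X) T' v.
have -> : \bigcup_(v in X) T v = A :|: \bigcup_(v in X) T v.
  apply/esym/setUidPr/bigcupsP => v vX.
  by apply: subset_trans (sT v) _; apply: bigcup_sup vX.
apply/esym/mrank_spanU => i /bigcupP[v vX iT]; apply: (@mrank_span i (T' v)).
  exact: bigcup_sup vX.
apply/eqP; rewrite eqn_leq [X in _ && X]mrankS ?subsetUr // andbT eT mrankS //.
by rewrite subUset sub1set iT sT.
Qed.
End Rank.

(** Merges obstructions: each element of [B] has its own [good] object, and joins yield one that
    serves all of [B]. The seed [x0] is for empty [B]. *)
Lemma join_all (A : finType) (B : {set A}) (L : Type) (good : L -> Prop)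
    (R : A -> L -> Prop) (x0 : L) :
  good x0 -> (forall a, a \in B -> exists2 x, good x & R a x) ->
  (forall x y, good x -> good y ->
     exists2 z, good z & forall a, R a x \/ R a y -> R a z) ->
  exists2 x, good x & forall a, a \in B -> R a x.
Proof.
move=> g0 ex join; have [n] := ubnP #|B|; elim: n B ex => // n IHn B ex /ltnSE len.
have [->|[a aB]] := set_0Vmem B; first by exists x0 => // a; rewrite inE.
have [||x gx Rx] := IHn (B :\ a).
- by move=> b; rewrite inE => /andP[_]; apply: ex.
- by have := cardsD1 a B; rewrite aB; lia.
have [y gy Ry] := ex a aB; have [z gz Rz] := join x y gx gy.
exists z => // b bB; apply: Rz; have [->|ne] := eqVneq b a; first by right.
by left; apply: Rx; rewrite !inE ne.
Qed.

(** * Hyperedges inside a set, in-degrees and the choice of heads *)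

Section Hyperedges.
Variables (V E : finType) (ends : E -> {set V}).
Implicit Types (X Y : {set V}) (Q : {set E}) (h : E -> V).

Definition inside Q X := \sum_(e in Q) (ends e \subset X).
(** The in-degree of the set [X] when each [e] in [Q] is directed towards its head [h e]. *)
Definition entering h Q X := \sum_(e in Q) ((h e \in X) && ~~ (ends e \subset X)).

Lemma insideD1 Q X e : e \in Q -> inside Q X = (ends e \subset X) + inside (Q :\ e) X.
Proof. by move=> eQ; rewrite /inside (big_setD1 e). Qed.

Lemma enteringD1 h Q X e : e \in Q ->
  entering h Q X = ((h e \in X) && ~~ (ends e \subset X)) + entering h (Q :\ e) X.
Proof. by move=> eQ; rewrite /entering (big_setD1 e). Qed.

Lemma inside_supmod Q X Y : inside Q X + inside Q Y <= inside Q (X :|: Y) + inside Q (X :&: Y).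
Proof.
rewrite /inside -!big_split; apply: leq_sum => e _ /=; rewrite subsetI.
have sUX : ends e \subset X -> ends e \subset X :|: Y by move/subset_trans; apply; apply: subsetUl.
have sUY : ends e \subset Y -> ends e \subset X :|: Y by move/subset_trans; apply; apply: subsetUr.
move: sUX sUY; case: (ends e \subset X); case: (ends e \subset Y);
  case: (ends e \subset X :|: Y) => //= sX sY; by [have := sX isT | have := sY isT].
Qed.

Lemma entering_submod h Q X Y :
  entering h Q (X :|: Y) + entering h Q (X :&: Y) <= entering h Q X + entering h Q Y.
Proof.
rewrite /entering -!big_split; apply: leq_sum => e _ /=; rewrite subsetI !inE.
have sUX : ends e \subset X -> ends e \subset X :|: Y by move/subset_trans; apply; apply: subsetUl.
have sUY : ends e \subset Y -> ends e \subset X :|: Y by move/subset_trans; apply; apply: subsetUr.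
move: sUX sUY; case: (h e \in X); case: (h e \in Y); case: (ends e \subset X);
  case: (ends e \subset Y); case: (ends e \subset X :|: Y) => //= sX sY;
  by [have := sX isT | have := sY isT].
Qed.

(** Heads are assigned one hyperedge at a time. If no end of [e] can be its head, every end lies in
    a set that is tight for the first hypothesis and does not contain [ends e]. Such sets are closed
    under union, yet their union contains all ends of [e]. *)
Lemma heads_of_indegrees (v0 : V) Q (d : V -> nat) :
  (forall X, inside Q X <= fsum d X) -> fsum d [set: V] = #|Q| ->
  (forall e, ends e != set0) ->
  exists h, (forall e, e \in Q -> h e \in ends e) /\
    forall X, \sum_(e in Q) (h e \in X) = fsum d X.
Proof.
move=> dom eQ n0; have [n] := ubnP #|Q|.
elim: n Q d dom eQ => // n IHn Q d dom eQ /ltnSE len.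
have [Q0|[e eIn]] := set_0Vmem Q.
  have d0 X : fsum d X = 0.
    by have := fsumS d (subsetT X); rewrite eQ Q0 cards0; lia.
  exists (fun=> v0); split=> [e|X]; first by rewrite Q0 inE.
  by rewrite Q0 big_set0 d0.
pose ok v := [&& v \in ends e, 0 < d v &
  [forall X : {set V}, inside (Q :\ e) X <= fsum (decr d v) X]].
case: (pickP ok) => [v /and3P[ve dv /forallP dom']|no].
  have cQ : #|Q| = #|Q :\ e|.+1 by rewrite (cardsD1 e) eIn.
  have [|||h [hE hs]] := IHn (Q :\ e) (decr d v).
  - by move=> X; apply: dom'.
  - by have := fsum_decr [set: V] dv; rewrite inE; lia.
  - by lia.
  exists (fun e' => if e' == e then v else h e'); split.
    move=> e' e'Q; case: eqP => [->//|/eqP ne]; apply: hE; by rewrite !inE ne.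
  move=> X; rewrite (big_setD1 e) //= eqxx -(fsum_decr X dv) -hs addnC; congr (_ + _).
  by apply: eq_bigr => e' ; rewrite !inE => /andP[/negPf -> _].
pose good X := (inside Q X == fsum d X) && ~~ (ends e \subset X).
have [|||X /andP[_ /negP sX] HX] := @join_all V (ends e) {set V} good (fun v X => v \in X) set0.
- rewrite /good fsum0 subset0 n0 andbT /inside big1 // => e' _.
  by rewrite subset0 (negPf (n0 e')).
(* For [d v = 0] the singleton of [v] is the tight set; otherwise it is a set violated once [e] is
   removed and [d v] lowered. *)
- move=> v ve; have := no v; rewrite /ok ve /=; case: (posnP (d v)) => [d0 _|dv /=].
    case: (boolP (ends e \subset [set v])) => [s1|ns]; last first.
      exists [set v]; rewrite ?inE // /good ns fsum1 d0 andbT.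
      by have := dom [set v]; rewrite fsum1 d0; lia.
    by have := dom [set v]; rewrite (insideD1 _ eIn) s1 fsum1 d0.
  move=> /negbT; rewrite negb_forall => /existsP[X]; rewrite -ltnNge => lt.
  have := dom X; rewrite (insideD1 X eIn) -(fsum_decr X dv) => le.
  exists X; last by move: lt le; case: (v \in X) => //; lia.
  rewrite /good (insideD1 X eIn) -(fsum_decr X dv).
  have vX : v \in X by move: lt le; case: (v \in X) => //; lia.
  by move: lt le; rewrite vX; case: (ends e \subset X) => /=; lia.
- move=> X Y /andP[/eqP tX sX] /andP[/eqP tY sY]; exists (X :|: Y); last first.
    by move=> v; rewrite inE => -[->|->]; rewrite ?orbT.
  (* If [e] lay inside the union, it would add one hyperedge to what supermodularity on [Q :\ e]
     already forces there. *)
  have := inside_supmod (Q :\ e) X Y; have := fsumUI d X Y.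
  have := dom (X :|: Y); have := dom (X :&: Y); rewrite /good.
  move: tX tY; rewrite !(insideD1 _ eIn) (negPf sX) (negPf sY) subsetI (negPf sX) /=.
  by case: (ends e \subset X :|: Y) => /=; lia.
by case: sX; apply/subsetP.
Qed.
End Hyperedges.

(** * Choosing the roots at the vertices *)

Section Roots.
Variables (V I : finType) (M : matroid I) (Sv : V -> {set I}) (rho : {set V} -> nat) (k : nat).
Implicit Types (X Y : {set V}) (T : V -> {set I}) (t : V -> nat).

Definition cup T X := \bigcup_(v in X) T v.

Lemma cupU T X Y : cup T (X :|: Y) = cup T X :|: cup T Y.
Proof. exact: bigcup_setU. Qed.

Lemma cupS T X Y : X \subset Y -> cup T X \subset cup T Y.
Proof. by move=> /setUidPr <-; rewrite cupU subsetUl. Qed.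

Lemma cup1 T v : cup T [set v] = T v.
Proof. exact: big_set1. Qed.

Lemma sub_cup T X v : v \in X -> T v \subset cup T X.
Proof. exact: bigcup_sup. Qed.

Lemma cupI T X Y : cup T (X :&: Y) \subset cup T X :&: cup T Y.
Proof. by rewrite subsetI !cupS ?subsetIl ?subsetIr. Qed.

Definition adjoin T v i : V -> {set I} := fun w => if w == v then i |: T v else T w.

Lemma cup_adjoin T v i X : cup (adjoin T v i) X = if v \in X then i |: cup T X else cup T X.
Proof.
case: ifP => vX; last first.
  by apply: eq_bigr => w wX; rewrite /adjoin; case: eqP => // e; rewrite -e wX in vX.
rewrite /cup (big_setD1 v vX) [in RHS](big_setD1 v vX) /= setUA {1}/adjoin eqxx.
congr (_ :|: _).
by apply: eq_bigr => w; rewrite !inE /adjoin => /andP[/negPf ->].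
Qed.

(** [T v] holds the roots already chosen at [v], and [t v] counts the slots left there. The
    condition interpolates between the covering inequality ([T] empty) and the rank condition on
    root sets ([t] zero, [Y] empty). *)
Definition slack_ok T t : Prop := forall X Y, Y \subset X -> X != set0 ->
  k <= mrank M (cup T X :|: cup Sv Y) + fsum t (X :\: Y) + rho X.

Hypothesis rho_submod : forall X Y, X :&: Y != set0 ->
  rho (X :|: Y) + rho (X :&: Y) <= rho X + rho Y.

Definition slack_okb T t := [forall X : {set V}, [forall Y : {set V},
  (Y \subset X) && (X != set0) ==>
  (k <= mrank M (cup T X :|: cup Sv Y) + fsum t (X :\: Y) + rho X)]].

Lemma slack_okP T t : reflect (slack_ok T t) (slack_okb T t).
Proof.
apply: (iffP forallP) => [H X Y sYX X0|H X].
  by have /forallP/(_ Y) := H X; rewrite sYX X0.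
by apply/forallP => Y; apply/implyP => /andP[sYX X0]; apply: H.
Qed.

Lemma slack_okPn T t : ~~ slack_okb T t -> exists X Y, [/\ Y \subset X, X != set0 &
  mrank M (cup T X :|: cup Sv Y) + fsum t (X :\: Y) + rho X < k].
Proof.
rewrite negb_forall => /existsP[X]; rewrite negb_forall => /existsP[Y].
by rewrite negb_imply -ltnNge => /andP[/andP[sYX X0] lt]; exists X, Y.
Qed.

Lemma mrank_cup_submod T X1 Y1 X2 Y2 :
  mrank M (cup T (X1 :|: X2) :|: cup Sv (Y1 :|: Y2)) +
  mrank M (cup T (X1 :&: X2) :|: cup Sv (Y1 :&: Y2)) <=
  mrank M (cup T X1 :|: cup Sv Y1) + mrank M (cup T X2 :|: cup Sv Y2).
Proof.
apply: leq_trans (mrank_submod M _ _); rewrite !cupU setUACA leq_add2l mrankS //.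
rewrite subsetI; apply/andP; split; apply: setUSS; apply: cupS; rewrite ?subsetIl ?subsetIr //.
Qed.

(* If no element of Sv v could be used for a slot of v, the union of the tight pairs
   obstructing them would span Sv v, so v could be added to its second component. *)
Lemma choose_root T t v : slack_ok T t -> 0 < t v ->
  slack_ok T (decr t v) \/
  exists2 i, i \in Sv v & slack_ok (adjoin T v i) (decr t v).
Proof.
move=> C tv.
case: (boolP (slack_okb T (decr t v))) => [/slack_okP|no0]; first by left.
case: (boolP [exists i in Sv v, slack_okb (adjoin T v i) (decr t v)]) => [|noi].
  by case/existsP => i /andP[iS /slack_okP H]; right; exists i.
exfalso.
pose span (p : {set V} * {set V}) := cup T p.1 :|: cup Sv p.2.
(* Lowering [t v] affects only pairs with [v] in the first component and not in the second. *)
pose good (p : {set V} * {set V}) := [&& p.2 \subset p.1, v \in p.1, v \notin p.2 &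
  k == mrank M (span p) + fsum t (p.1 :\: p.2) + rho p.1].
pose R i p := mrank M (i |: span p) = mrank M (span p).
have n0 (X : {set V}) : v \in X -> X != set0 by move=> vX; apply/set0Pn; exists v.
(* Dropping the slot without a new root fails too, which provides the seed even if [Sv v] is
   empty. *)
have [X0 [Y0 [s0 X00 lt0]]] := slack_okPn no0.
have g0 : good (X0, Y0).
  have := C _ _ s0 X00; have := fsum_decr (X0 :\: Y0) tv; rewrite /good /span /= s0 inE.
  have := subsetP s0 v; move: lt0.
  by case: (v \in X0); case: (v \in Y0) => //=; lia.
have [|p q|[X Y] /and4P[/= sYX vX vY /eqP e] HR] := @join_all _ (Sv v) _ good R _ g0.
- move=> i iS; move/existsPn/(_ i): noi; rewrite iS /= => /slack_okPn[X [Y [sYX Xn0]]].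
  have := C _ _ sYX Xn0; have := fsum_decr (X :\: Y) tv; rewrite cup_adjoin inE.
  have := subsetP sYX v; case: (boolP (v \in X)) => vX; last first.
    by rewrite andbF => _ /=; clear; lia.
  have := mrankS M (subsetUr [set i] (cup T X :|: cup Sv Y)); rewrite setUA => leR.
  case: (boolP (v \in Y)) => vY /= _ e1 le lt; first by move: leR e1 le lt; clear; lia.
  exists (X, Y); last by move: leR e1 le lt; rewrite /R /span /= setUA; clear; lia.
  by move: leR e1 le lt; rewrite /good /span /= sYX vX vY /=; clear; lia.
- case: p q => [X1 Y1] [X2 Y2] /and4P[/= s1 vX1 vY1 /eqP e1] /and4P[/= s2 vX2 vY2 /eqP e2].
  exists (X1 :|: X2, Y1 :|: Y2); last first.
    move=> i [] Ri; apply: mrank_span Ri; rewrite /span /= !cupU.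
      by apply: setUSS; rewrite subsetUl.
    by apply: setUSS; rewrite subsetUr.
  have sU : Y1 :|: Y2 \subset X1 :|: X2 by rewrite setUSS.
  have vI : v \in X1 :&: X2 by rewrite inE vX1.
  have vU : v \in X1 :|: X2 by rewrite inE vX1.
  have := C _ _ sU (n0 _ vU); have := C _ _ (setISS s1 s2) (n0 _ vI).
  have := mrank_cup_submod T X1 Y1 X2 Y2.
  have := rho_submod (n0 _ vI); rewrite /good /span /= sU vU inE negb_or vY1 vY2 /=.
  by have := fsum_diffUI t s1 s2; move: e1 e2; rewrite /span /=; clear; lia.
(* At [(X, v |: Y)] the rank is that of [(X, Y)], but [t v] is lost, so the condition fails
   there. *)
have sYv : v |: Y \subset X by rewrite subUset sub1set vX.
have := C _ _ sYv (n0 _ vX).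
have -> : cup T X :|: cup Sv (v |: Y) = span (X, Y) :|: Sv v.
  by rewrite cupU cup1 /span setUAC setUA.
rewrite mrank_spanU; last exact: HR.
have := fsumD t sYv; have := fsumD t sYX.
have : fsum t (v |: Y) = t v + fsum t Y by rewrite /fsum big_setU1.
by move: e tv; clear; lia.
Qed.

(** Each unit of [t] is discarded or turned into a root until [t] vanishes. *)
Lemma choose_roots T t : (forall v, T v \subset Sv v) -> slack_ok T t ->
  exists T', [/\ forall v, T' v \subset Sv v, forall v, #|T' v| <= #|T v| + t v &
    forall X, X != set0 -> k <= mrank M (cup T' X) + rho X].
Proof.
have [n] := ubnP (fsum t [set: V]); elim: n T t => // n IHn T t /ltnSE len sT C.
case: (pickP (fun v => 0 < t v)) => [v tv|t0]; last first.
  exists T; split=> // [v|X X0]; first by apply: leq_addr.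
  have := C X set0 (sub0set _) X0; rewrite /cup big_set0 setU0 setD0.
  by rewrite [fsum t X]big1 ?addn0 // => v _; have := t0 v; case: (t v).
have lt : fsum (decr t v) [set: V] < n by have := fsum_decr [set: V] tv; rewrite inE; lia.
case: (choose_root C tv) => [C'|[i iS C']].
  have [T' [sT' cT' H]] := IHn T _ lt sT C'; exists T'; split=> // w.
  by apply: leq_trans (cT' w) _; rewrite leq_add2l leq_subr.
have [|T' [sT' cT' H]] := IHn (adjoin T v i) _ lt _ C'.
  by move=> w; rewrite /adjoin; case: eqP => // ->; rewrite subUset sub1set iS sT.
exists T'; split=> // w; apply: leq_trans (cT' w) _; rewrite /adjoin /decr.
case: (eqVneq w v) => [->|_]; last by rewrite subn0.
by have := cardsU1 i (T v); case: (i \notin T v) => /=; lia.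
Qed.
End Roots.

(** * Growing the root sets along hyperedges *)

Section Branchings.
Variables (V E I : finType) (ends : E -> {set V}) (M : matroid I) (h : E -> V).
Implicit Types (X Y : {set V}) (Q : {set E}) (U : V -> {set I}).

Let k := mrank M [set: I].

Definition root_connected Q U : Prop := forall X, X != set0 ->
  k <= mrank M (cup U X) + entering ends h Q X.

Definition rtight Q U X := (X != set0) && (k == mrank M (cup U X) + entering ends h Q X).

Lemma mrank_cupUI U X Y : mrank M (cup U (X :|: Y)) + mrank M (cup U (X :&: Y))
  <= mrank M (cup U X) + mrank M (cup U Y).
Proof.
by apply: leq_trans (mrank_submod M _ _); rewrite cupU leq_add2l mrankS // cupI.
Qed.

(** An index at an end of [e] that cannot be passed on to [h e] is spanned by a tight set which [e]
    enters; an index spanned by [U (h e)] is spanned by every such set. These sets are closed under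
    union, so a single one spans all the indices. *)
Lemma grow_obstruction Q U e : root_connected Q U -> e \in Q ->
  (forall i, i \in cup U (ends e) -> mrank M (i |: U (h e)) != mrank M (U (h e)) ->
     ~ root_connected (Q :\ e) (adjoin U (h e) i)) ->
  mrank M (U (h e) :|: cup U (ends e)) != mrank M (U (h e)) ->
  exists X, [/\ rtight Q U X, h e \in X, ~~ (ends e \subset X)
    & forall i, i \in cup U (ends e) -> mrank M (i |: cup U X) = mrank M (cup U X)].
Proof.
move=> C eQ no nsp.
pose good X := [&& rtight Q U X, h e \in X & ~~ (ends e \subset X)].
pose R i X := mrank M (i |: cup U X) = mrank M (cup U X).
have n0 X : h e \in X -> X != set0 by move=> ?; apply/set0Pn; exists (h e).
have bad i : i \in cup U (ends e) -> mrank M (i |: U (h e)) != mrank M (U (h e)) ->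
    exists2 X, good X & R i X.
  move=> iU ni; case: (boolP [forall X : {set V}, (X != set0) ==>
    (k <= mrank M (cup (adjoin U (h e) i) X) + entering ends h (Q :\ e) X)]) => [/forallP H|].
    by case: (no i iU ni) => X X0; have := H X; rewrite X0.
  rewrite negb_forall => /existsP[X]; rewrite negb_imply -ltnNge => /andP[X0].
  rewrite cup_adjoin => lt; have := C X X0; rewrite (enteringD1 _ _ _ eQ).
  have leU := mrankS M (subsetUr [set i] (cup U X)); move: lt.
  case: (boolP (h e \in X)) => hX /=; last by lia.
  case: (boolP (ends e \subset X)) => sX /= lt le; first by lia.
  exists X; last by rewrite /R; lia.
  by rewrite /good hX sX /rtight X0 (enteringD1 _ _ _ eQ) hX sX /=; lia.
have [i iU ni] : exists2 i, i \in cup U (ends e) & mrank M (i |: U (h e)) != mrank M (U (h e)).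
  apply/exists_inP; apply: contraNT nsp => /exists_inPn H; apply/eqP/mrank_spanU => i iU.
  by apply/eqP; have := H i iU; rewrite negbK.
have [X0 g0 _] := bad i iU ni.
have [||X gX HX] := @join_all _ (cup U (ends e)) _ good R _ g0.
- move=> j jU; have [ej|nj] := eqVneq (mrank M (j |: U (h e))) (mrank M (U (h e))); last exact: bad.
  by exists X0 => //; apply: mrank_span ej; apply: sub_cup; case/and3P: g0.
- move=> X Y /and3P[/andP[_ /eqP tX] hX sX] /and3P[/andP[_ /eqP tY] hY sY].
  exists (X :|: Y); last first.
    by move=> j [] Rj; apply: mrank_span Rj; apply: cupS; rewrite ?subsetUl ?subsetUr.
  have hI : h e \in X :&: Y by rewrite inE hX.
  have hU : h e \in X :|: Y by rewrite inE hX.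
  have := C _ (n0 _ hI); have := C _ (n0 _ hU); have := mrank_cupUI U X Y.
  have := entering_submod ends h (Q :\ e) X Y; rewrite /good /rtight n0 //.
  move: tX tY; rewrite !(enteringD1 _ _ _ eQ) hX hY hI hU subsetI (negPf sX) (negPf sY) /=.
  by case: (ends e \subset X :|: Y) => /=; clear; lia.
by case/and3P: gX => tX hX sX; exists X.
Qed.

Lemma entering_setT Q : entering ends h Q [set: V] = 0.
Proof. by rewrite /entering big1 // => e _; rewrite subsetT andbF. Qed.

(** Otherwise a minimal tight set [X] with a vertex [v] not spanning it is taken, and a hyperedge
    [e] inside [X] entering the part of [X] spanned by [v]. By minimality [U (h e)] spans the
    intersection of [X] with the tight set obstructing [e]; uncrossing then makes [U (h e)] span an
    end of [e] outside that part, a contradiction. *)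
Lemma grow_step Q U v0 : root_connected Q U -> mrank M (U v0) < k ->
  exists e i, [/\ e \in Q, i \in cup U (ends e), mrank M (i |: U (h e)) != mrank M (U (h e))
    & root_connected (Q :\ e) (adjoin U (h e) i)].
Proof.
move=> C lt0.
pose step e i := [&& e \in Q, i \in cup U (ends e), mrank M (i |: U (h e)) != mrank M (U (h e)) &
  [forall X : {set V}, (X != set0) ==>
    (k <= mrank M (cup (adjoin U (h e) i) X) + entering ends h (Q :\ e) X)]].
case: (boolP [exists e, [exists i, step e i]]) => [|no].
  case/existsP => e /existsP[i /and4P[eQ iU ni /forallP H]]; exists e, i; split=> // X X0.
  by have := H X; rewrite X0.
exfalso; have {}no e : e \in Q -> mrank M (U (h e) :|: cup U (ends e)) != mrank M (U (h e)) ->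
  exists X, [/\ rtight Q U X, h e \in X, ~~ (ends e \subset X)
    & forall i, i \in cup U (ends e) -> mrank M (i |: cup U X) = mrank M (cup U X)].
  move=> eQ; apply: (grow_obstruction C eQ) => i iU ni H; move/existsPn/(_ e)/existsPn/(_ i): no.
  by rewrite /step eQ iU ni /= => /negP[]; apply/forallP => X; apply/implyP; apply: H.
pose bad X := rtight Q U X && [exists v in X, mrank M (U v) < mrank M (cup U X)].
(* Nothing enters the whole vertex set, so it is tight, and [v0] does not span it. *)
have badT : bad [set: V].
  have T0 : [set: V] != set0 by apply/set0Pn; exists v0; rewrite inE.
  have := C _ T0; rewrite /bad /rtight T0 entering_setT addn0 /= => le.
  have le' : mrank M (cup U [set: V]) <= k by rewrite mrankS ?subsetT.
  rewrite eqn_leq le le' /=; apply/existsP; exists v0; rewrite inE /=; lia.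
case: (@arg_minnP _ _ bad (fun X : {set V} => #|X|) badT) => X.
case/andP => tX /exists_inP[v vX ltv] minX; have /andP[X0 /eqP eX] := tX.
pose Z := [set w in X | mrank M (U v :|: U w) == mrank M (U v)].
have vZ : v \in Z by rewrite inE vX setUid eqxx.
have rZ : mrank M (cup U Z) <= mrank M (U v).
  rewrite -(@mrank_spanU _ M (U v) (cup U Z)) ?mrankS ?subsetUr // => i /bigcupP[w].
  rewrite inE => /andP[_ /eqP ew] iw; apply/eqP; rewrite eqn_leq [X in _ && X]mrankS ?subsetUr //.
  by rewrite andbT -ew mrankS // setUC setUS // sub1set.
(* [Z] has smaller rank than the tight set [X], so more hyperedges enter [Z] than [X]. *)
have [e eQ /and3P[hZ nZ sX]] : exists2 e, e \in Q &
    [&& h e \in Z, ~~ (ends e \subset Z) & ends e \subset X].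
  apply/exists_inP; apply: contraTT (ltv) => /exists_inPn H; rewrite -leqNgt.
  have Z0 : Z != set0 by apply/set0Pn; exists v.
  suff : entering ends h Q Z <= entering ends h Q X by have := C Z Z0; lia.
  apply: leq_sum => e eQ; have := H e eQ; case: (boolP (h e \in Z)) => //=.
  by rewrite inE => /andP[-> _]; case: (ends e \subset Z) => //= ->.
have /subsetPn[u ue uNZ] := nZ.
have uX : u \in X := subsetP sX u ue.
move: (hZ); rewrite inE => /andP[hX /eqP dw].
(* Otherwise [U v], which spans [U (h e)], would span [U u], putting [u] in [Z]. *)
have notspan : ~ (forall i, i \in U u -> mrank M (i |: U (h e)) = mrank M (U (h e))).
  move=> H; move: uNZ; rewrite inE uX /= => /negP[]; apply/eqP/mrank_spanU => i iu.
  have e1 := mrank_span (subsetUr (U v) (U (h e))) (H i iu).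
  apply/eqP; rewrite eqn_leq [X in _ && X]mrankS ?subsetUr // andbT.
  by rewrite -dw -e1 mrankS // setUS // subsetUl.
have nsp : mrank M (U (h e) :|: cup U (ends e)) != mrank M (U (h e)).
  apply/eqP => esp; apply: notspan => i iu.
  apply/eqP; rewrite eqn_leq [X in _ && X]mrankS ?subsetUr // andbT -esp mrankS // setUC setUS //.
  by rewrite sub1set (subsetP (sub_cup U ue)).
have [Y [tY hY nY spY]] := no e eQ nsp; have /andP[Y0 /eqP eY] := tY.
have hI : h e \in X :&: Y by rewrite inE hX.
have I0 : X :&: Y != set0 by apply/set0Pn; exists (h e).
have U0 : X :|: Y != set0 by apply/set0Pn; exists (h e); rewrite inE hX.
have smM := mrank_cupUI U X Y; have smE := entering_submod ends h Q X Y.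
have CI := C _ I0; have CU := C _ U0.
have tI : rtight Q U (X :&: Y).
  by rewrite /rtight I0 /=; move: smM smE CI CU eX eY; clear; lia.
(* [X :&: Y] is tight and misses an end of [e], so it is smaller than [X] and not [bad]. *)
have rI : mrank M (cup U (X :&: Y)) <= mrank M (U (h e)).
  rewrite leqNgt; apply/negP => ltI.
  have badI : bad (X :&: Y) by rewrite /bad tI; apply/exists_inP; exists (h e).
  have := minX _ badI; rewrite leqNgt => /negP[]; apply: proper_card; rewrite properE subsetIl /=.
  by apply: contra nY => sXI; apply: subset_trans sX (subset_trans sXI (subsetIr _ _)).
apply: notspan => i iu; apply/eqP; rewrite eqn_leq [X in _ && X]mrankS ?subsetUr // andbT.
have iX : i \in cup U X by apply: subsetP iu; apply: sub_cup.
(* Tightness makes the rank modular on [X] and [Y], and both span [i]; hence so does [X :&: Y], and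
   with it [U (h e)]. *)
have := mrank_submod M (cup U X) (i |: cup U Y).
rewrite spY; last by apply: subsetP iu; apply: sub_cup.
have s1 : cup U (X :|: Y) \subset cup U X :|: (i |: cup U Y).
  by rewrite cupU setUS // subsetUr.
have s2 : i |: cup U (X :&: Y) \subset cup U X :&: (i |: cup U Y).
  rewrite subsetI subUset sub1set iX (subset_trans (cupI _ _ _)) ?subsetIl //=.
  by apply: setUS; apply: cupS; apply: subsetIr.
have s3 : i |: U (h e) \subset i |: cup U (X :&: Y) by apply: setUS; apply: sub_cup.
by move: (mrankS M s1) (mrankS M s2) (mrankS M s3) smE CI CU eX eY rI; clear; lia.
Qed.

Variable R0 : V -> {set I}.
Hypothesis h_ends : forall e, h e \in ends e.

(* Edge e, with head h e and chosen tail tl e, belongs to the forest of the index own e;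
   the vertices of the forest of i are those v with i in U v; rt i v is the root of the
   component of v, and lvl i increases from tails to heads. *)
Record branching_state Q U (own : E -> option I) (tl : E -> V)
    (lvl : I -> V -> nat) (rt : I -> V -> V) : Prop := BranchingState {
  bs_indep : forall v, indep M (U v);
  bs_roots : forall v, R0 v \subset U v;
  bs_rt_root : forall i v, i \in R0 v -> rt i v = v;
  bs_rt : forall i v, i \in U v -> i \in R0 (rt i v);
  bs_edge : forall i v, i \in U v -> i \notin R0 v -> exists2 e, own e = Some i & h e = v;
  bs_fresh : forall e i, own e = Some i -> e \notin Q;
  bs_tl : forall e i, own e = Some i -> tl e \in ends e;
  bs_U : forall e i, own e = Some i -> i \in U (tl e) /\ i \in U (h e);
  bs_lvl : forall e i, own e = Some i -> lvl i (tl e) < lvl i (h e);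
  bs_rt_edge : forall e i, own e = Some i -> rt i (tl e) = rt i (h e);
  bs_inj : forall e e' i, own e = Some i -> own e' = Some i -> h e = h e' -> e = e' }.

(** [h e] joins the forest of [i] through a tail [u], one level above [u] and with the root of
    [u]. *)
Lemma branching_state_grow Q U own tl lvl rt e i :
  branching_state Q U own tl lvl rt -> e \in Q -> i \in cup U (ends e) ->
  mrank M (i |: U (h e)) != mrank M (U (h e)) ->
  exists own' tl' lvl' rt', branching_state (Q :\ e) (adjoin U (h e) i) own' tl' lvl' rt'.
Proof.
case=> ind sR rtR rtU ed fr tle Ue le re inj eQ /bigcupP[u ue iu] nsp.
have iN : i \notin U (h e).
  by apply: contra nsp => iU; rewrite (setUidPr _) ?sub1set.
have eN j : own e = Some j -> False by move/fr; rewrite eQ.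
have uh : u != h e by apply: contraNneq iN => <-.
have iR : i \notin R0 (h e) by apply: contra iN; apply: (subsetP (sR _)).
have adj j v : (j \in adjoin U (h e) i v) = ((j == i) && (v == h e)) || (j \in U v).
  by rewrite /adjoin; case: eqP => [->|_]; rewrite ?inE ?andbT ?andbF.
(* Earlier hyperedges of the forest of [i] avoid [h e], so new values there leave them intact. *)
have keep j e' : own e' = Some j -> ((j == i) && (tl e' == h e) = false) * ((j == i) && (h e' == h e) = false).
  by move=> oe; have [t1 t2] := Ue _ _ oe; split; apply/negP => /andP[/eqP ji /eqP eh];
     move: iN; rewrite -ji -eh ?t1 ?t2.
exists (fun e' => if e' == e then Some i else own e'), (fun e' => if e' == e then u else tl e'),
  (fun j v => if (j == i) && (v == h e) then (lvl i u).+1 else lvl j v),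
  (fun j v => if (j == i) && (v == h e) then rt i u else rt j v).
split.
- move=> v; rewrite /adjoin; case: (v =P h e) => [_|_]; last exact: ind.
  move: (ind (h e)); rewrite /indep cardsU1 iN.
  by move=> /eqP eU; have := mrankU1 M i (U (h e)); have := mrankS M (subsetUr [set i] (U (h e))); lia.
- by move=> v; apply/subsetP => j jR; rewrite adj (subsetP (sR v)) ?orbT.
- move=> j v jR; case: andP => [[/eqP ji /eqP vh]|_]; last exact: rtR.
  by move: iR; rewrite -ji -vh jR.
- move=> j v; rewrite adj; case: andP => [[/eqP -> _] _|_ /=]; exact: rtU.
- move=> j v; rewrite adj; case: andP => [[/eqP ji /eqP vh] _ _|_ /= jU jR].
    by exists e; rewrite ?eqxx ?ji.
  have [e' oe' he'] := ed j v jU jR; exists e' => //; case: eqP => // ee.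
  by case: (eN j); rewrite -ee.
- by move=> e' j; rewrite !inE; case: eqP => //= _; apply: fr.
- by move=> e' j; case: (e' =P e) => [-> _|_]; [exact: ue | apply: tle].
- move=> e' j; rewrite !adj; case: eqP => [-> [<-]|_ oe]; first by rewrite iu !eqxx orbT.
  by have [-> ->] := Ue _ _ oe; rewrite !orbT.
- move=> e' j; case: (e' =P e) => [-> [<-]|_ oe]; first by rewrite !eqxx (negPf uh) /=.
  by rewrite !(keep _ _ oe); apply: le.
- move=> e' j; case: (e' =P e) => [-> [<-]|_ oe]; first by rewrite !eqxx (negPf uh) /=.
  by rewrite !(keep _ _ oe); apply: re.
- move=> e1 e2 j; case: (e1 =P e) => [->|_]; case: (e2 =P e) => [->|_] //; last exact: inj.
  + by move=> [<-] oe he; have [] := keep _ _ oe; rewrite he !eqxx.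
  + by move=> oe [ij] he; move: (keep _ _ oe).2; rewrite he ij !eqxx.
Qed.

Lemma branchings_exist Q : (forall v, indep M (R0 v)) -> root_connected Q R0 ->
  exists U own tl lvl rt, branching_state set0 U own tl lvl rt /\ forall v, basis M (U v).
Proof.
move=> iR C.
(* No hyperedge is owned yet, so the tails [h] and the levels 0 are placeholders. *)
have st0 : branching_state Q R0 (fun=> None) h (fun _ _ => 0) (fun _ v => v).
  by split=> // i v ->.
suff grow n : forall Q' U, #|Q'| < n -> root_connected Q' U ->
    (exists own tl lvl rt, branching_state Q' U own tl lvl rt) ->
    exists U own tl lvl rt, branching_state set0 U own tl lvl rt /\ forall v, basis M (U v).
  by apply: (grow #|Q|.+1 Q R0) => //; do 4 eexists; exact: st0.
elim: n => // n IHn {st0 C}Q U /ltnSE len C [own [tl [lvl [rt st]]]].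
case: (pickP (fun v => mrank M (U v) < k)) => [v0 lt0|full].
  have [e [i [eQ iU ni C']]] := grow_step C lt0.
  apply: (IHn (Q :\ e) _ _ C' (branching_state_grow st eQ iU ni)).
  by have := cardsD1 e Q; rewrite eQ; lia.
exists U, own, tl, lvl, rt; split.
  (* [Q] occurs only in [bs_fresh], which is trivial for [set0]. *)
  by case: st => *; split=> // *; rewrite inE.
move=> v; apply/basisP; have iU := bs_indep st v; split=> //; move: (iU) => /eqP <-.
by apply/eqP; rewrite eqn_leq mrankS ?subsetT //= leqNgt full.
Qed.
End Branchings.

(** * Acyclicity of levelled graphs *)

Section LevelledGraphs.
Variables (V E : finType) (D : graph V E) (tl h : E -> V) (lvl : V -> nat).
Hypothesis D_ends : forall e, e \in gedges D -> gends D e = [set tl e; h e].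
Hypothesis D_lvl : forall e, e \in gedges D -> lvl (tl e) < lvl (h e).

(* At a vertex of maximal level of a cycle both cycle edges would have their head. *)
Lemma levelled_acyclic : (forall e e', e \in gedges D -> e' \in gedges D -> h e = h e' -> e = e') ->
  forall c, ~~ graph_cycle D c.
Proof.
move=> inj c; apply/negP => /and5P[c0 /allP cE u1 u2 cyc].
case: c => // p0 c' in c0 cE u1 u2 cyc *; set c := p0 :: c' in c0 cE u1 u2 cyc.
have p0c : p0 \in c by rewrite inE eqxx.
case: (@arg_maxnP _ p0 (fun p => p \in c) (fun p => lvl p.1) p0c) => p pc mx.
have end_neq e x y : e \in gedges D -> gends D e = [set x; y] -> x != y.
  move=> eD; rewrite (D_ends eD) => eq; apply/eqP => xy; have := D_lvl eD.
  have : tl e \in [set x; y] by rewrite -eq !inE eqxx.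
  have : h e \in [set x; y] by rewrite -eq !inE eqxx orbT.
  by rewrite xy !inE !orbb => /eqP -> /eqP ->; rewrite ltnn.
have head e x y : e \in gedges D -> gends D e = [set x; y] -> lvl y <= lvl x -> h e = x.
  move=> eD eq le; have := end_neq e x y eD eq; have := D_lvl eD; move: eq; rewrite (D_ends eD) => eq.
  have : h e \in [set x; y] by rewrite -eq !inE eqxx orbT.
  have : tl e \in [set x; y] by rewrite -eq !inE eqxx.
  rewrite !inE => /orP[] /eqP et /orP[] /eqP eh //; rewrite et eh; first by lia.
  by rewrite ltnn.
have nc : next c p \in c by rewrite mem_next.
have oc : prev c p \in c by rewrite mem_prev.
have /eqP n1 := next_cycle cyc pc; have /eqP o1 := prev_cycle cyc pc.
have hp := head _ _ _ (cE _ pc) n1 (mx _ nc).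
rewrite setUC in o1; have ho := head _ _ _ (cE _ oc) o1 (mx _ oc).
(* The two cycle edges at [p.1] coincide; edges of a cycle being distinct, [p] precedes itself, and
   its edge would be a loop. *)
have e2 : p.2 = (prev c p).2 by apply: inj; rewrite ?cE // hp ho.
have pp : prev c p = p.
  apply/eqP; apply: contraTT u2 => ne.
  have : ~~ uniq (map snd c); last by [].
  have i1 := index_mem p c; have i2 := index_mem (prev c p) c; rewrite pc in i1; rewrite oc in i2.
  apply/negP => /(uniqP (p0.2)) U.
  have /(congr1 (nth p0 c)) : index p c = index (prev c p) c.
    by apply: U; rewrite ?inE ?size_map // !(nth_map p0) // !nth_index.
  by rewrite !nth_index // => ep; rewrite -ep eqxx in ne.
by have := end_neq _ _ _ (cE _ oc) o1; rewrite pp eqxx.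
Qed.
End LevelledGraphs.

(** * Rooted forests obtained from a branching state *)

Section ForestOfBranching.
Variables (V I : finType) (H : hypergraph V) (ends : hedge H -> {set V}) (M : matroid I).
Variables (h : hedge H -> V) (R0 U : V -> {set I}) (Q : {set hedge H}).
Variables (own : hedge H -> option I) (tl : hedge H -> V).
Variables (lvl : I -> V -> nat) (rt : I -> V -> V) (t : hedge H -> {set V}).
Hypothesis st : branching_state ends M h R0 Q U own tl lvl rt.
Hypothesis t_ends : forall e i, own e = Some i -> t e = [set tl e; h e].
Hypothesis t_trim : forall e i, own e = Some i -> t e \subset hverts e.

Definition branching_packing (i : I) : {set V} * {set hedge H} :=
  ([set v | i \in R0 v], [set e | own e == Some i]).

Lemma branching_gverts i :
  gverts (trimmed_forest (branching_packing i) t) = [set v | i \in U v].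
Proof.
apply/setP => v; rewrite !inE /=; apply/idP/idP.
  case/orP => [|/exists_inP[e]]; first by apply: (subsetP (bs_roots st v)).
  rewrite inE => /eqP oe; rewrite (t_ends oe); have [u1 u2] := bs_U st oe.
  by rewrite !inE => /orP[] /eqP ->.
move=> iU; case: (boolP (i \in R0 v)) => //= nR.
have [e oe <-] := bs_edge st iU nR; apply/exists_inP; exists e; first by rewrite inE oe.
by rewrite (t_ends oe) !inE eqxx orbT.
Qed.

(** [rt i] is constant on components and fixes roots, so a component has at most one root;
    descending from heads to tails connects each vertex with its [rt]. *)
Lemma branching_trims_rooted i : trims_rooted (branching_packing i) t.
Proof.
have tc e : own e = Some i -> #|t e| = 2.
  move=> oe; rewrite (t_ends oe) cards2; have := bs_lvl st oe.
  by case: eqP => // ->; rewrite ltnn.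
(* Stated for any such graph, since it serves both before and after isolated vertices are
   dropped. *)
have ac (D : graph V (hedge H)) : gedges D = [set e | own e == Some i] -> gends D = t ->
    forall c, ~~ graph_cycle D c.
  move=> eD tD; apply: (@levelled_acyclic _ _ D tl h (lvl i)) => [e|e|e e'];
    rewrite eD ?inE ?tD => /eqP oe; first exact: t_ends oe; first exact: (bs_lvl st oe).
  by move=> /eqP; exact: (bs_inj st oe).
set D := trimmed_forest (branching_packing i) t.
have sym : symmetric (adjacent D).
  by move=> x y; rewrite /adjacent; apply: eq_existsb => e; rewrite setUC.
have csym := sym_connect_sym sym.
have rt_adj x y : adjacent D x y -> rt i x = rt i y.
  case/exists_inP => e; rewrite inE => /eqP oe /eqP /= ee; rewrite (t_ends oe) in ee.
  have := bs_rt_edge st oe; have := bs_lvl st oe.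
  have : tl e \in [set x; y] by rewrite -ee !inE eqxx.
  have : h e \in [set x; y] by rewrite -ee !inE eqxx orbT.
  by rewrite !inE => /orP[] /eqP -> /orP[] /eqP ->; rewrite ?ltnn.
have rt_con x y : connect (adjacent D) x y -> rt i x = rt i y.
  case/connectP => p; elim: p x => [|z p IH] x /= => [_ -> //|/andP[xz pz] ey].
  by rewrite (rt_adj _ _ xz); apply: IH pz ey.
have con_rt n v : lvl i v < n -> i \in U v -> connect (adjacent D) (rt i v) v.
  elim: n v => // n IHn v /ltnSE le iU; case: (boolP (i \in R0 v)) => iR.
    by rewrite (bs_rt_root st iR) connect0.
  have [e oe he] := bs_edge st iU iR; have [u1 _] := bs_U st oe.
  have lt := bs_lvl st oe; rewrite he in lt.
  have := IHn (tl e) (leq_trans lt le) u1; rewrite (bs_rt_edge st oe) he => c.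
  apply: connect_trans c _; apply: connect1; apply/exists_inP; exists e; first by rewrite inE oe.
  by rewrite /= (t_ends oe) he.
split.
- by move=> e; rewrite inE => /eqP oe; rewrite tc //; split=> //; apply: t_trim oe.
- split; last by apply: ac.
  by move=> e; rewrite inE => /eqP oe /=; rewrite tc // subsetT.
split.
- split; last by apply: ac.
  move=> e; rewrite /D /= inE => /eqP oe; split; first exact: tc.
  apply/subsetP => v ve; rewrite inE in_setT /=; apply/orP; right.
  by apply/exists_inP; exists e; rewrite ?inE ?oe.
- by rewrite branching_gverts; apply/subsetP => v; rewrite !inE; apply: (subsetP (bs_roots st v)).
move=> C /imsetP[x xD ->]; move: (xD); rewrite /D branching_gverts inE => iU.
have iR := bs_rt st iU; apply/eqP/cards1P; exists (rt i x); apply/setP => y; rewrite !inE.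
rewrite -/D; apply/andP/eqP => [[yR /andP[_ cxy]]|->].
  by rewrite (rt_con _ _ cxy) (bs_rt_root st yR).
have sR := subsetP (bs_roots st (rt i x)) _ iR.
by rewrite iR /= csym (con_rt (lvl i x).+1) // andbT; split.
Qed.
End ForestOfBranching.

(** * Hyperedges of a packing that cross a partition *)

(** The level is the distance from [R], finite because every component has a root; the edge is the
    last one of a shortest path. *)
Lemma rooted_forest_level (V E : finType) (R : {set V}) (D : graph V E) :
  rooted_forest R D -> exists lvl : V -> nat, forall v, v \in gverts D -> v \notin R ->
    exists e u, [/\ e \in gedges D, gends D e = [set u; v] & lvl u < lvl v].
Proof.
case=> -[gD _] sR comp.
have sym : symmetric (adjacent D).
  by move=> x y; rewrite /adjacent; apply: eq_existsb => e; rewrite setUC.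
have csym := sym_connect_sym sym.
pose reach n := iter n (fun A => A :|: [set y | [exists x in A, adjacent D x y]]) R.
have reach_path p x n : x \in reach n -> path (adjacent D) x p -> last x p \in reach (n + size p).
  elim: p x n => [|y p IH] x n xn /=; first by rewrite addn0.
  case/andP => xy yp; rewrite addnS -addSn; apply: IH yp.
  by rewrite /= inE; apply/orP; right; rewrite inE; apply/exists_inP; exists x.
have reachW v : v \in gverts D -> exists n, v \in reach n.
  move=> vD; pose C := [set y in gverts D | connect (adjacent D) v y].
  have /eqP/cards1P[r /setP/(_ r)] : #|R :&: C| = 1 by apply: comp; apply/imsetP; exists v.
  rewrite !inE eqxx => /and3P[rR _]; rewrite csym => /connectP[p pp ->].
  by exists (0 + size p); apply: reach_path pp.
have : forall v, exists n, v \in gverts D -> v \in reach n /\ forall m, v \in reach m -> n <= m.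
  move=> v; case: (boolP (v \in gverts D)) => vD; last by exists 0.
  by exists (ex_minn (reachW v vD)) => _; case: ex_minnP.
move=> /fin_all_exists[lvl Hl]; exists lvl => v vD vR; have [] := Hl v vD.
case: (lvl v) => [|n] /=; first by rewrite (negPf vR).
rewrite inE => /orP[vn /(_ n vn)|]; first by rewrite ltnn.
rewrite inE => /exists_inP[u un /exists_inP[e eD /eqP ee]] _; exists e, u; split=> //.
have [_ /subsetP sD] := gD e eD; have uD : u \in gverts D by apply: sD; rewrite ee !inE eqxx.
by have [_ /(_ n un)] := Hl u uD.
Qed.

Lemma leq_card_rel (A B : finType) (SA : {set A}) (SB : {set B}) (R : A -> B -> Prop) :
  (forall a, a \in SA -> exists2 b, b \in SB & R a b) ->
  (forall a a' b, a \in SA -> a' \in SA -> R a b -> R a' b -> a = a') ->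
  #|SA| <= #|SB|.
Proof.
move=> ex inj; have [->|[a0 a0S]] := set_0Vmem SA; first by rewrite cards0.
have [b0 _ _] := ex a0 a0S.
have /fin_all_exists[F HF] : forall a, exists b, a \in SA -> b \in SB /\ R a b.
  move=> a; case: (boolP (a \in SA)) => [/ex[b bS Rb]|_]; last by exists b0.
  by exists b.
rewrite -(@card_in_imset _ _ F) => [|a a' aS aS' e].
  by apply/subset_leq_card/subsetP => _ /imsetP[a aS ->]; have [] := HF a aS.
by apply: (inj a a' (F a)) => //; have [_] := HF _ aS; last rewrite e; have [] := HF _ aS'.
Qed.

Section Subadditivity.
Variables (V I : finType) (M : matroid I).

Lemma mrank_subadd (A B : {set I}) : mrank M (A :|: B) <= mrank M A + mrank M B.
Proof. by have := mrank_submod M A B; lia. Qed.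

Lemma indepS (A B : {set I}) : A \subset B -> indep M B -> indep M A.
Proof.
rewrite /indep => sAB /eqP eB; have := mrank_subadd (B :&: A) (B :\: A).
rewrite setID (setIidPr sAB) eB.
have := mrank_card M (B :\: A); have := mrank_card M A.
by have := cardsID A B; rewrite (setIidPr sAB); lia.
Qed.

Lemma mrank_cup_card (T : V -> {set I}) (X : {set V}) :
  mrank M (cup T X) <= fsum (fun v => #|T v|) X.
Proof.
rewrite /cup /fsum; elim/big_rec2: _ => [|v n A _ le]; first by rewrite (leq_trans (mrank_card _ _)) ?cards0.
by apply: leq_trans (mrank_subadd _ _) _; apply: leq_add => //; apply: mrank_card.
Qed.

Lemma mrank_cupD (T : V -> {set I}) (X Y : {set V}) : Y \subset X ->
  mrank M (cup T X) <= mrank M (cup T Y) + fsum (fun v => #|T v|) (X :\: Y).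
Proof.
move=> sYX; rewrite -{1}(setID X Y) cupU (setIidPr sYX).
by apply: leq_trans (mrank_subadd _ _) _; rewrite leq_add2l mrank_cup_card.
Qed.
End Subadditivity.

(** The basis at a vertex of [X] is independent, so the number of its indices rooted in [X] is at
    most the rank subtracted in the sum; each other index supplies its own crossing hyperedge. *)
Lemma partition_crossing (V I : finType) (M : matroid I) (H : hypergraph V) (K : finType)
    (P : K -> {set V} * {set hedge H}) (t : hedge H -> {set V}) (sigma : I -> K)
    (Pt : {set {set V}}) :
  trims_packing P t -> injective sigma ->
  (forall v, basis M [set i | v \in gverts (trimmed_forest (P (sigma i)) t)]) ->
  partition Pt [set: V] ->
  \sum_(X in Pt) (mrank M [set: I] - mrank M (cup (fun v => [set i | v \in (P (sigma i)).1]) X))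
    <= crossing H Pt.
Proof.
move=> [disj tr] sI bas Ppt; set T := fun v => [set i | v \in (P (sigma i)).1].
have /and3P[cP tI nP] := Ppt.
pose W i := gverts (trimmed_forest (P (sigma i)) t).
have uniqX X X' v : X \in Pt -> X' \in Pt -> v \in X -> v \in X' -> X = X'.
  move=> XP XP' vX vX'; apply/eqP; apply: contraTT vX' => ne.
  by have /trivIsetP/(_ X X' XP XP' ne) := tI; rewrite disjoint_subset => /subsetP/(_ v vX).
have /fin_all_exists[lvl Hl] : forall i, exists lvl : V -> nat, forall v, v \in W i ->
    v \notin (P (sigma i)).1 ->
    exists e u, [/\ e \in (P (sigma i)).2, t e = [set u; v], u \in W i & lvl u < lvl v].
  move=> i; have [_ _ rf] := tr (sigma i); have [lvl Hl] := rooted_forest_level rf.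
  exists lvl => v vW vR; have [e [u [eD eE lt]]] := Hl v vW vR; exists e, u; split=> //.
  by have [[/(_ e eD)[_ /subsetP sW] _] _ _] := rf; apply: sW; rewrite eE !inE eqxx.
pose B v := [set i | v \in W i].
pose Bx (X : {set V}) := if [pick v in X] is Some v then B v else set0.
pose SA := [set p : {set V} * I | (p.1 \in Pt) && (p.2 \in Bx p.1 :\: cup T p.1)].
have cardSA : #|SA| = \sum_(X in Pt) #|Bx X :\: cup T X|.
  rewrite -sum1_card; under [RHS]eq_bigr do rewrite -sum1_card.
  by rewrite pair_big_dep; apply: eq_bigl => p; rewrite inE.
have leSA : \sum_(X in Pt) (mrank M [set: I] - mrank M (cup T X)) <= #|SA|.
  rewrite cardSA; apply: leq_sum => X XP; rewrite leq_subLR.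
  have [x xX] : exists x, x \in X by apply/set0Pn; apply: contraNneq nP => <-.
  rewrite /Bx; case: pickP => [v vX|/(_ x)]; last by rewrite xX.
  have /basisP[iB cB] := bas v; rewrite -cB -/(B v) -(cardsID (cup T X) (B v)) leq_add2r.
  have := indepS (subsetIl (B v) (cup T X)) iB; rewrite /indep => /eqP <-.
  by rewrite mrankS ?subsetIr.
apply: leq_trans leSA _; rewrite /crossing.
pose Rel (p : {set V} * I) (e : hedge H) := e \in (P (sigma p.2)).2 /\
  exists u v, [/\ t e = [set u; v], lvl p.2 u < lvl p.2 v & v \in p.1].
apply: (@leq_card_rel _ _ _ _ Rel) => [[X i]|[X i] [X' i'] e].
  rewrite inE /= => /andP[XP]; rewrite inE => /andP[iT]; rewrite /Bx.
  case: pickP => [v vX|]; last by rewrite inE.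
  rewrite inE => vW.
  have vP : (v \in X) && (v \in W i) by rewrite [v \in X]vX.
  case: (@arg_minnP _ v (fun w => (w \in X) && (w \in W i)) (lvl i) vP) => w /andP[wX wW] mn.
  have wR : w \notin (P (sigma i)).1.
    by apply: contra iT => wR; apply/bigcupP; exists w; rewrite ?inE.
  have [e [u [eP eE uW lt]]] := Hl i w wW wR; exists e; last by split=> //; exists u, w.
  (* A block containing the hyperedge would be [X], and [u] would lie in [X] at a lower level than
     [w]. *)
  rewrite inE; apply/negP => /exists_inP[X' XP' sX'].
  have [tre _ _] := tr (sigma i); have [_ ste] := tre e eP.
  have sub x : x \in [set u; w] -> x \in X' by rewrite -eE => /(subsetP ste)/(subsetP sX').
  have eX : X = X' by apply: (uniqX X X' w) => //; apply: sub; rewrite !inE eqxx orbT.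
  have uX : u \in X by rewrite eX; apply: sub; rewrite !inE eqxx.
  by have := mn u; rewrite uX uW => /(_ isT); rewrite leqNgt lt.
rewrite !inE /= => /andP[XP _] /andP[XP' _] [/= ei [u [v [eE lt vX]]]] [/= ei' [u' [v' [eE' lt' vX']]]].
(* Disjointness of the forests determines the index; the higher end of the trimmed edge then
   determines the block. *)
have ii : i = i'.
  apply/eqP; apply: contraTT ei' => ne.
  have ns : sigma i != sigma i' by apply: contra ne => /eqP/sI ->.
  by have := disj _ _ ns; rewrite disjoint_subset => /subsetP/(_ e ei).
rewrite -{}ii in lt' ei' *.
have vv : v' = v.
  have : v' \in [set u; v] by rewrite -eE eE' !inE eqxx orbT.
  have : u' \in [set u; v] by rewrite -eE eE' !inE eqxx.
  rewrite !inE => /orP[] /eqP eu /orP[] /eqP ev //; move: lt lt'; rewrite eu ev; last first.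
    by move=> lt1 lt2; have := ltn_trans lt1 lt2; rewrite ltnn.
  by rewrite ltnn.
by rewrite vv in vX'; rewrite (uniqX X X' v).
Qed.

Lemma crossing_add_edges (V : finType) (G : hypergraph V) n (F : 'I_n -> edge V) (Pt : {set {set V}}) :
  crossing (add_edges G F) Pt <= crossing G Pt + n.
Proof.
set A := [set e : hedge G | ~~ [exists X in Pt, hverts e \subset X]].
rewrite -[n in _ + n]card_ord -cardsT.
apply: leq_trans (leq_add (leq_imset_card inl A) (leq_imset_card inr [set: 'I_n])).
apply: leq_trans (leq_card_setU _ _); apply/subset_leq_card/subsetP => -[e|j]; rewrite inE /= => H.
  by rewrite inE imset_f // inE.
by rewrite inE orbC imset_f // inE.
Qed.

(** * Subfamilies meeting a vertex set *)

Section Meeting.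
Variables (V I : finType) (S : I -> {set V}).

Lemma meeting_cup (X : {set V}) : meeting S X = cup (fun v => meeting S [set v]) X.
Proof.
apply/setP => i; rewrite inE; apply/set0Pn/bigcupP => [[v]|[v vX]].
  by rewrite inE => /andP[vS vX]; exists v => //; rewrite inE; apply/set0Pn; exists v; rewrite !inE vS /=.
by rewrite inE => /set0Pn[w]; rewrite !inE => /andP[wS /eqP ww]; exists w; rewrite inE wS ww.
Qed.

Lemma mem_meeting1 i v : (i \in meeting S [set v]) = (v \in S i).
Proof.
rewrite inE; apply/set0Pn/idP => [[w]|vS]; first by rewrite !inE => /andP[wS /eqP <-].
by exists v; rewrite !inE vS eqxx.
Qed.

Lemma cup_sub_meeting (T : V -> {set I}) (X : {set V}) :
  (forall v, T v \subset meeting S [set v]) -> cup T X \subset meeting S X.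
Proof.
move=> sT; rewrite meeting_cup; apply/bigcupsP => v vX.
by apply: subset_trans (sT v) _; apply: (sub_cup (fun v => meeting S [set v])).
Qed.
End Meeting.

Lemma partition_setT (V : finType) : 0 < #|V| -> partition [set [set: V]] [set: V].
Proof.
move=> V0; rewrite /partition cover1 eqxx trivIset1 inE /= eq_sym.
by apply/set0Pn; have /card_gt0P[v _] := V0; exists v; rewrite inE.
Qed.

Lemma sum_card_roots (V K : finType) (A : K -> {set V}) :
  \sum_k #|A k| = fsum (fun v => #|[set k | v \in A k]|) [set: V].
Proof.
rewrite fsumT (eq_bigr (fun k => \sum_(v : V) (v \in A k : nat))); last first.
  by move=> k _; rewrite -sum1_card [in LHS]big_mkcond /=; apply: eq_bigr => v _; case: ifP.
rewrite exchange_big /=; apply: eq_bigr => v _; rewrite -sum1_card [in RHS]big_mkcond /=.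
by apply: eq_bigr => k _; rewrite inE; case: ifP.
Qed.

(** * Necessity of the conditions *)

(** The members whose forest has a root at [v] form an independent set [T v], of size between [f v]
    and [g v]; the conditions follow from ranks and sizes of these sets. *)
Lemma packing_necessary (V : finType) (G : hypergraph V) (I : finType) (S : I -> {set V})
    (alpha beta gamma : nat) (f g : V -> nat) (M : matroid I) (V_nonempty : 0 < #|V|)
    (F : 'I_gamma -> edge V) (K : finType) (P : K -> {set V} * {set hedge (add_edges G F)}) :
  matroid_based S M P -> bounded f g P -> limited alpha beta P ->
  [/\ alpha <= beta,
      forall Y, rank_deficit S M Y + fsum f Y <= beta /\ rank_deficit S M Y <= fsum g (~: Y),
      forall v : V, f v <= minn (mrank M (meeting S [set v])) (g v),
      alpha <= \sum_(v : V) minn (mrank M (meeting S [set v])) (g v)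
    & (forall P : {set {set V}}, partition P [set: V] ->
         \sum_(X in P) \max_(Y : {set V} | Y \subset X) (rank_deficit S M Y + fsum g Y)
           <= fsum g [set: V] + gamma + crossing G P)
      /\
      (forall P : {set {set V}}, partition P [set: V] ->
         \sum_(X in P) \max_(Y : {set V} | Y \subset X) (rank_deficit S M Y + fsum f Y)
           <= beta + gamma + crossing G P)].
Proof.
move=> [t [S' [sigma [tr sS' bs eS' bas]]]] bnd /andP[lim1 lim2].
pose T v := [set i | v \in (P (sigma i)).1]; pose N v := #|T v|.
have sI : injective sigma by apply: bij_inj.
have NE v : N v = #|[set k | v \in (P k).1]|.
  rewrite -(on_card_preimset (f := sigma)); last exact: onW_bij.
  by apply: eq_card => i; rewrite !inE.
have Nb v : f v <= N v <= g v by rewrite NE.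
have NT : \sum_k #|(P k).1| = fsum N [set: V].
  by rewrite sum_card_roots !fsumT; apply: eq_bigr => v _; rewrite NE.
rewrite NT in lim1 lim2.
have sT v : T v \subset meeting S [set v].
  by apply/subsetP => i; rewrite inE mem_meeting1 eS' => /(subsetP (sS' i)).
have iT v : mrank M (T v) = N v.
  have /basisP[iB _] := bas v; apply/eqP; apply: indepS iB; apply/subsetP => i.
  have [_ _ [_ /subsetP sW _]] := tr.2 (sigma i).
  by have := sW v; rewrite /T !inE.
have key Pt := partition_crossing tr sI bas (Pt := Pt); rewrite -/T in key.
pose k := mrank M [set: I].
(* Nothing crosses the one-block partition, so the rooted indices have full rank. *)
have kT : k <= mrank M (cup T [set: V]).
  have := key _ (partition_setT V_nonempty); rewrite big_set1 /crossing.
  rewrite (_ : [set e | _] = set0) ?cards0 ?leqn0 ?subn_eq0 //.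
  by apply/setP => e; rewrite !inE; apply/negbTE; rewrite negbK; apply/exists_inP; exists [set: V]; rewrite ?inE.
have defi (X Y : {set V}) : Y \subset X -> rank_deficit S M Y <= (k - mrank M (cup T X)) + fsum N (X :\: Y).
  move=> sYX; have := mrank_cupD M T sYX; have := mrankS M (cup_sub_meeting Y sT).
  by rewrite /rank_deficit -/k -/N; lia.
have fN X : fsum f X <= fsum N X by apply: leq_fsum => v; case/andP: (Nb v).
have Ng X : fsum N X <= fsum g X by apply: leq_fsum => v; case/andP: (Nb v).
(* Serves both partition conditions: with [g] for [c] and [hh], and with [f] for [c] and [N] for
   [hh], where [N] totals at most [beta]. *)
have bound (c : V -> nat) Pt (hh : V -> nat) : (forall X, fsum c X <= fsum hh X) ->
    (forall X, fsum N X <= fsum hh X) -> partition Pt [set: V] ->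
    \sum_(X in Pt) \max_(Y : {set V} | Y \subset X) (rank_deficit S M Y + fsum c Y)
      <= fsum hh [set: V] + gamma + crossing G Pt.
  move=> ch Nh Ppt; have := key _ Ppt; have := @crossing_add_edges V G gamma F Pt.
  have : \sum_(X in Pt) \max_(Y : {set V} | Y \subset X) (rank_deficit S M Y + fsum c Y)
     <= \sum_(X in Pt) (fsum hh X + (k - mrank M (cup T X))).
    apply: leq_sum => X XP; apply/bigmax_leqP => Y sYX.
    have := defi X Y sYX; have := ch Y; have := Nh (X :\: Y); have := fsumD hh sYX; clear; lia.
  by rewrite big_split /= fsum_partition // -/k; clear; lia.
split.
- exact: leq_trans lim1 lim2.
- move=> Y; have := defi _ _ (subsetT Y); rewrite setTD; have := fsumD N (subsetT Y); rewrite setTD.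
  have := fN Y; have := Ng (~: Y); move: kT lim2; clear; lia.
- move=> v; have /andP[fv gv] := Nb v.
  by rewrite leq_min (leq_trans fv gv) andbT (leq_trans fv) // -iT mrankS.
- apply: leq_trans lim1 _; rewrite fsumT.
  apply: leq_sum => v _; rewrite leq_min -{1}iT mrankS //=; by case/andP: (Nb v).
split=> Pt Ppt; first exact: bound.
by apply: leq_trans (bound f Pt N fN _ Ppt) _ => //; rewrite !leq_add2r.
Qed.

Lemma fsum_between (V : finType) (lo hi : V -> nat) m : (forall v, lo v <= hi v) ->
  fsum lo [set: V] <= m <= fsum hi [set: V] ->
  exists c : V -> nat, (forall v, lo v <= c v <= hi v) /\ fsum c [set: V] = m.
Proof.
have [n] := ubnP (m - fsum lo [set: V]); elim: n lo => // n IHn lo /ltnSE len le /andP[m1 m2].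
case: (pickP (fun v => lo v < hi v)) => [v lv|no]; last first.
  exists lo; split=> [v|]; first by rewrite leqnn le.
  apply/eqP; rewrite eqn_leq m1 /=; apply: leq_trans m2 (leq_fsum _ _) => v.
  by rewrite leqNgt no.
case: (ltnP (fsum lo [set: V]) m) => [lt|ge]; last first.
  by exists lo; split=> [w|]; [rewrite leqnn le | apply/eqP; rewrite eqn_leq m1 ge].
have [|w||c [cb ce]] := IHn (incr lo v).
- by rewrite fsum_incr inE; move: len lt; clear; lia.
- by rewrite /incr; case: eqP => [->|_]; rewrite ?addn1 // addn0.
- by rewrite fsum_incr inE m2 andbT addn1.
exists c; split=> // w; have := cb w; rewrite /incr => /andP[h1 ->]; rewrite andbT.
by apply: leq_trans h1; apply: leq_addr.
Qed.

(** * Sufficiency of the conditions *)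

Section Sufficiency.
Variables (V : finType) (G : hypergraph V) (I : finType) (S : I -> {set V}) (gamma : nat).
Variable M : matroid I.

Let E : finType := (hedge G + 'I_gamma)%type.

(* The gamma additional edges are first represented by hyperedges spanning all of V. *)
Definition full_ends (e : E) : {set V} := if e is inl e' then hverts e' else [set: V].

Let k := mrank M [set: I].
Let a (X : {set V}) := inside full_ends [set: E] X.
Let b (Y : {set V}) := mrank M (meeting S Y).

Lemma full_ends_n0 : 0 < #|V| -> forall e, full_ends e != set0.
Proof.
move=> V0 [e|j] /=; last by rewrite -card_gt0 cardsT.
by rewrite -card_gt0; apply: ltnW; apply: hverts_card.
Qed.

Lemma inside_le X : a X <= #|E|.
Proof.
rewrite /a /inside -sum1_card; apply: leq_trans (_ : \sum_(e in [set: E]) 1 <= _).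
  by apply: leq_sum => e _; apply: leq_b1.
by rewrite sum1_card cardsT sum1_card.
Qed.

(** A nonempty hyperedge lies in at most one block, and in none if it crosses; the [gamma] copies of
    [V] lie in none, as [V] is not a block. *)
Lemma inside_partition (P : {set {set V}}) : 0 < #|V| -> partition P [set: V] -> [set: V] \notin P ->
  \sum_(X in P) a X + gamma + crossing G P <= #|E|.
Proof.
move=> V0 /and3P[cP tI nP] TP.
have uniq1 e : \sum_(X in P) (full_ends e \subset X) <= [exists X in P, full_ends e \subset X].
  case: (boolP [exists X in P, full_ends e \subset X]) => [/exists_inP[X XP sX]|/exists_inPn no].
    rewrite (big_setD1 X) //= sX big1 // => X'; rewrite !inE => /andP[ne XP'].
    apply/eqP; rewrite eqb0; apply/negP => sX'.
    have /set0Pn[v ve] := full_ends_n0 V0 e.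
    have /trivIsetP/(_ X' X XP' XP ne) := tI; rewrite disjoint_subset => /subsetP/(_ v).
    by rewrite inE (subsetP sX _ ve) => /(_ (subsetP sX' _ ve)).
  by rewrite big1 // => X XP; rewrite (negPf (no X XP)).
rewrite /a /inside exchange_big /=.
have -> : crossing G P = \sum_(e : hedge G) ~~ [exists X in P, hverts e \subset X].
  by rewrite /crossing -sum1_card big_mkcond; apply: eq_bigr => e _; rewrite inE; case: ifP.
rewrite (eq_bigl xpredT) => [|e]; last by rewrite inE.
rewrite big_sumType /= card_sum card_ord.
have -> : \sum_(j < gamma) \sum_(X in P) ([set: V] \subset X) = 0.
  rewrite big1 // => j _; rewrite big1 // => X XP; apply/eqP; rewrite eqb0; apply: contra TP.
  by rewrite subTset => /eqP <-.
rewrite addn0 addnAC leq_add2r -big_split -sum1_card /=; apply: leq_sum => e _.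
apply: leq_trans (leq_add (uniq1 (inl e)) (leqnn _)) _.
by rewrite /=; case: [exists X in P, _].
Qed.

(** Writing [k] as deficit plus rank turns the equality into a sum of demands at the sets [Y X],
    bounded by the maxima. The one-block partition is treated apart through the third hypothesis,
    because it contains the [gamma] copies of [V]. *)
Lemma partition_demand (c : V -> nat) (B : nat) : 0 < #|V| ->
  (forall P : {set {set V}}, partition P [set: V] ->
     \sum_(X in P) \max_(Y : {set V} | Y \subset X) (rank_deficit S M Y + fsum c Y)
     <= B + gamma + crossing G P) ->
  (forall Y, rank_deficit S M Y + fsum c Y <= B) ->
  forall (P : {set {set V}}) (Y : {set V} -> {set V}) n, partition P [set: V] ->
    (forall X, X \in P -> Y X \subset X) ->
    \sum_(X in P) (k + a X) = \sum_(X in P) (b (Y X) + fsum c (X :\: Y X)) + n ->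
    fsum c [set: V] + n <= B + #|E|.
Proof.
move=> V0 H H1 P Y n PP sY eP.
have bk Z : k = rank_deficit S M Z + b Z by rewrite /rank_deficit subnK // mrankS ?subsetT.
have {eP} -> : fsum c [set: V] + n =
    \sum_(X in P) (rank_deficit S M (Y X) + fsum c (Y X)) + \sum_(X in P) a X.
  apply: (@addnI (\sum_(X in P) b (Y X))); rewrite -(fsum_partition c PP) addnA -!big_split /=.
  rewrite (eq_bigr (fun X => b (Y X) + fsum c (X :\: Y X) + fsum c (Y X))) => [|X XP]; last first.
    by rewrite -(fsumD c (sY X XP)) addnA.
  rewrite big_split addnAC -eP -big_split; apply: eq_bigr => X XP /=.
  by rewrite {1}(bk (Y X)); clear; lia.
case: (boolP ([set: V] \in P)) => TP; last first.
  have := inside_partition V0 PP TP; have := H P PP.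
  have : \sum_(X in P) (rank_deficit S M (Y X) + fsum c (Y X)) <=
    \sum_(X in P) \max_(Y : {set V} | Y \subset X) (rank_deficit S M Y + fsum c Y).
    apply: leq_sum => X XP.
    exact: (leq_bigmax_cond (F := fun Y => rank_deficit S M Y + fsum c Y) _ (sY X XP)).
  clear; lia.
have /and3P[_ tI nP] := PP.
have -> : P = [set [set: V]].
  apply/setP => X; rewrite inE; apply/idP/eqP => [XP|->//]; apply/eqP; apply: contraNT nP => ne.
  have /trivIsetP/(_ _ _ XP TP ne) := tI; rewrite -setI_eq0 setIT => /eqP e.
  by rewrite -e.
rewrite !big_set1; have := H1 (Y [set: V]); have := inside_le [set: V]; clear; lia.
Qed.

Lemma meeting_submod X Y : b (X :|: Y) + b (X :&: Y) <= b X + b Y.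
Proof.
by rewrite /b !(meeting_cup S); apply: mrank_cupUI.
Qed.

Lemma covering_vectors (beta : nat) (f g : V -> nat) : 0 < #|V| ->
  (forall v, f v <= g v) ->
  (forall Y, rank_deficit S M Y + fsum f Y <= beta /\ rank_deficit S M Y <= fsum g (~: Y)) ->
  (forall P : {set {set V}}, partition P [set: V] ->
     \sum_(X in P) \max_(Y : {set V} | Y \subset X) (rank_deficit S M Y + fsum g Y)
       <= fsum g [set: V] + gamma + crossing G P) ->
  (forall P : {set {set V}}, partition P [set: V] ->
     \sum_(X in P) \max_(Y : {set V} | Y \subset X) (rank_deficit S M Y + fsum f Y)
       <= beta + gamma + crossing G P) ->
  exists t d, [/\ covers k a b t d, forall v, f v <= t v <= g v,
    fsum t [set: V] <= beta & fsum d [set: V] = #|E|].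
Proof.
move=> V0 fg c2 c5 c6; have /card_gt0P[v0 _] := V0.
have a_sm X Y : X :&: Y != set0 -> a X + a Y <= a (X :|: Y) + a (X :&: Y).
  by move=> _; apply: inside_supmod.
have b_le X : b X <= k by rewrite mrankS ?subsetT.
have exch := covers_exchange a_sm meeting_submod b_le.
(* With in-degree [k + #|E|] everywhere, one vertex of [X] suffices. *)
have C0 : covers k a b f (fun=> k + #|E|).
  apply/coversP => X Y _ /set0Pn[v vX]; apply: leq_trans (leq_addl _ _).
  apply: leq_trans (_ : fsum (fun=> k + #|E|) [set v] <= _).
    by rewrite fsum1 leq_add2l inside_le.
  by apply: fsumS; rewrite sub1set.
(* The cap [f] keeps [t] equal to [f], so this round only lowers [d]. *)
have [t [d [P [Y [C1 tb _ [PP sY] e1]]]]] := exch _ _ f (fun v => leqnn (f v)) C0.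
have le1 : fsum t [set: V] + fsum d [set: V] <= beta + #|E|.
  apply: leq_trans (partition_demand V0 c6 (fun Y => (c2 Y).1) PP sY e1).
  by rewrite leq_add2r; apply: leq_fsum => v; case/andP: (tb v).
have tg v : t v <= g v by case/andP: (tb v) => _ /leq_trans; apply.
have ft v : f v <= t v by case/andP: (tb v).
have [t1 [d1 [P1 [Y1 [C2 tb1 le2 [PP1 sY1] e2]]]]] := exch _ _ g tg C1.
have le3 : fsum d1 [set: V] <= #|E|.
  have H1 Z : rank_deficit S M Z + fsum g Z <= fsum g [set: V].
    have := (c2 Z).2; have := fsumD g (subsetT Z); rewrite setTD; clear; lia.
  by rewrite -(leq_add2l (fsum g [set: V])); apply: partition_demand V0 c5 H1 _ _ _ PP1 sY1 e2.
have ft1 v : f v <= t1 v by apply: leq_trans (ft v) _; case/andP: (tb1 v).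
have tg1 v : t1 v <= g v by case/andP: (tb1 v).
(* If [t1] exceeds [beta], the excess is moved back to [d1]. Covering persists because [d] counts on
   all of [X], and the bound on the joint total keeps [d2] within [#|E|]. *)
have [t2 [d2 [C3 tb2 le4 le5]]] : exists t2 d2, [/\ covers k a b t2 d2, forall v, f v <= t2 v <= t1 v,
    fsum t2 [set: V] <= beta & fsum d2 [set: V] <= #|E|].
  case: (leqP (fsum t1 [set: V]) beta) => [le|gt].
    by exists t1, d1; split=> // v; rewrite ft1 leqnn.
  have fb : fsum f [set: V] <= beta by apply: leq_trans (c2 _).1; apply: leq_addl.
  have [|t2 [tb2 e3]] := fsum_between ft1 (m := beta); first by rewrite fb ltnW.
  have dE X : fsum (fun v => d1 v + (t1 v - t2 v)) X + fsum t2 X = fsum d1 X + fsum t1 X.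
    rewrite /fsum -!big_split; apply: eq_bigr => v _ /=; case/andP: (tb2 v) => _; clear; lia.
  exists t2, (fun v => d1 v + (t1 v - t2 v)); split=> //; first last.
  - by have := dE [set: V]; move: e3 le2 le1 gt; clear; lia.
  - by rewrite e3.
  apply/coversP => X Z sZX X0; have := coversP _ _ _ _ _ C2 X Z sZX X0; have := dE X.
  have := fsumD t1 sZX; have := fsumD t2 sZX.
  have : fsum t2 Z <= fsum t1 Z by apply: leq_fsum => v; case/andP: (tb2 v).
  clear; lia.
(* In-degrees are padded to total exactly [#|E|], so that they can be realised by heads. *)
have [v||d3 [db3 e4]] := @fsum_between V d2 (fun v => d2 v + #|E|) #|E|; first exact: leq_addr.
  rewrite le5 /=; apply: leq_trans (_ : fsum (fun v => d2 v + #|E|) [set v0] <= _).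
    by rewrite fsum1 leq_addl.
  exact/fsumS/subsetT.
exists t2, d3; split=> // [|v].
  by apply: covers_mono C3 => // v; case/andP: (db3 v).
by case/andP: (tb2 v) => -> /leq_trans; apply.
Qed.

(** After heads and roots realise [d] and [t], the root sets are cut down to independent sets [B v]
    and enlarged again to meet the bounds [f] and [alpha]. *)
Lemma oriented_roots (alpha beta : nat) (f g : V -> nat) : 0 < #|V| -> alpha <= beta ->
  (forall v : V, f v <= minn (mrank M (meeting S [set v])) (g v)) ->
  alpha <= \sum_(v : V) minn (mrank M (meeting S [set v])) (g v) ->
  forall t d, covers k a b t d -> (forall v, f v <= t v <= g v) ->
  fsum t [set: V] <= beta -> fsum d [set: V] = #|E| ->
  exists (h : E -> V) (R0 : V -> {set I}),
    [/\ forall e, h e \in full_ends e, root_connected full_ends M h [set: E] R0,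
        forall v, indep M (R0 v) /\ R0 v \subset meeting S [set v],
        forall v, f v <= #|R0 v| <= g v
      & alpha <= fsum (fun v => #|R0 v|) [set: V] <= beta].
Proof.
move=> V0 ab c3 c4 t d /coversP C tb tbeta dE; have /card_gt0P[v0 _] := V0.
have b_le X : b X <= k by rewrite mrankS ?subsetT.
have [||h [hE hd]] := heads_of_indegrees v0 (Q := [set: E]) (d := d) _ _ (full_ends_n0 V0).
- move=> X; have [->|X0] := eqVneq X set0.
    by rewrite fsum0 /inside big1 // => e _; rewrite subset0 (negPf (full_ends_n0 V0 e)).
  have := C X X (subxx X) X0; rewrite setDv fsum0; have := b_le X; rewrite /a; clear; lia.
- by rewrite dE cardsT.
pose rho := entering full_ends h [set: E].
(* A hyperedge with its head in [X] either enters [X] or lies inside it. *)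
have dle X : fsum d X <= rho X + a X.
  rewrite -hd /rho /a /entering /inside -big_split; apply: leq_sum => e _ /=.
  by case: (h e \in X) => //; case: (full_ends e \subset X).
pose Sv v := meeting S [set v].
have slack : slack_ok M Sv rho k (fun=> set0) t.
  move=> X Y sYX X0; rewrite {1}/cup big1 // set0U -meeting_cup.
  by have := C X Y sYX X0; have := dle X; rewrite /b; clear; lia.
have rho_sm X Y : X :&: Y != set0 -> rho (X :|: Y) + rho (X :&: Y) <= rho X + rho Y.
  by move=> _; apply: entering_submod.
have [|T [sT cT kT]] := choose_roots rho_sm _ slack; first by move=> v; apply: sub0set.
have /fin_all_exists[B HB] : forall v, exists B : {set I}, [/\ B \subset T v, indep M B & mrank M B = mrank M (T v)].
  by move=> v; apply: indep_base.
have Bt v : #|B v| <= t v.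
  have [sB _ _] := HB v; apply: leq_trans (subset_leq_card sB) _.
  by have := cT v; rewrite cards0.
have Br v : #|B v| <= minn (mrank M (Sv v)) (g v).
  have [sB /eqP <- _] := HB v; rewrite leq_min mrankS ?(subset_trans sB) //=.
  by have [_ /eqP -> _] := HB v; apply: leq_trans (Bt v) _; case/andP: (tb v).
have mle v : maxn (f v) #|B v| <= minn (mrank M (Sv v)) (g v) by rewrite geq_max c3 Br.
(* This is the least total compatible with [alpha] and the lower bounds; it is at most [beta], as
   [f] and the sizes of [B] are below [t]. *)
have [|m [mb me]] := @fsum_between V _ _ (maxn alpha (fsum (fun v => maxn (f v) #|B v|) [set: V])) mle.
  rewrite leq_maxr geq_max [fsum (fun v => minn _ _) _]fsumT c4 /= -fsumT.
  exact: leq_fsum.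
have /fin_all_exists[R0 HR] : forall v, exists R : {set I},
    [/\ B v \subset R, R \subset Sv v, indep M R & #|R| = m v].
  move=> v; have [sB iB _] := HB v; apply: indep_extend => //; first exact: subset_trans sB (sT v).
  have /andP[l1 l2] := mb v; rewrite (leq_trans _ l1) ?leq_maxr //=.
  by apply: leq_trans l2 (geq_minl _ _).
have cR v : #|R0 v| = m v by have [] := HR v.
exists h, R0; split.
- by move=> e; apply: hE; rewrite inE.
- move=> X X0; apply: leq_trans (kT X X0) _; rewrite leq_add2r.
  rewrite -(@mrank_bigcup_span _ M _ T B X); last by move=> v; have [] := HB v.
    apply: mrankS; apply/bigcupsP => v vX; have [sR _ _ _] := HR v.
    by apply: subset_trans sR _; apply: (sub_cup R0).
  by move=> v; have [] := HB v.
- by move=> v; have [] := HR v.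
- move=> v; rewrite cR; have /andP[l1 l2] := mb v.
  by rewrite (leq_trans _ l1) ?leq_maxl // (leq_trans l2) // geq_minr.
have -> : fsum (fun v => #|R0 v|) [set: V] = fsum m [set: V] by apply: eq_bigr => v _; rewrite cR.
rewrite me leq_maxl geq_max ab /=; apply: leq_trans tbeta; apply: leq_fsum => v.
by rewrite geq_max Bt andbT; case/andP: (tb v).
Qed.

(** The packing is indexed by [I] itself; an owned copy of [V] becomes the edge joining its tail and
    head. *)
Lemma packing_of_branching (alpha beta : nat) (f g : V -> nat) (h : E -> V) (R0 : V -> {set I}) :
  (0 < gamma -> 1 < #|V|) ->
  (forall e, h e \in full_ends e) -> root_connected full_ends M h [set: E] R0 ->
  (forall v, indep M (R0 v) /\ R0 v \subset meeting S [set v]) ->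
  (forall v, f v <= #|R0 v| <= g v) ->
  alpha <= fsum (fun v => #|R0 v|) [set: V] <= beta ->
  exists (F : 'I_gamma -> edge V) (K : finType) (P : K -> {set V} * {set hedge (add_edges G F)}),
     [/\ packing P, matroid_based S M P, bounded f g P & limited alpha beta P].
Proof.
move=> gV hE C iR Rb Rt.
have [U [own [tl [lvl [rt [st bU]]]]]] := branchings_exist hE (fun v => (iR v).1) C.
have /fin_all_exists[F HF] : forall j : 'I_gamma, exists F : edge V,
    forall i, own (inr j) = Some i -> val F = [set tl (inr j); h (inr j)].
  move=> j; case oj: (own (inr j)) => [i|].
    have c2 : #|[set tl (inr j); h (inr j)]| == 2.
      by rewrite cards2; have := bs_lvl st oj; case: (tl (inr j) =P h (inr j)) => [->|_]; rewrite ?ltnn.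
    by exists (exist (fun e : {set V} => #|e| == 2) _ c2).
  (* A new edge owned by no forest may be any pair of vertices. *)
  have /card_gt1P[x [y [_ _ xy]]] : 1 < #|V| by apply: gV; case: j {oj} => j /=; case: gamma.
  have c2 : #|[set x; y]| == 2 by rewrite cards2 xy.
  by exists (exist (fun e : {set V} => #|e| == 2) _ c2).
pose H := add_edges G F; pose t (e : hedge H) := [set tl e; h e].
have t_ends (e : hedge H) i : own e = Some i -> t e = [set tl e; h e] by [].
have t_trim (e : hedge H) i : own e = Some i -> t e \subset hverts e.
  move=> oe; case: e oe => [e|j] oe /=.
    by rewrite subUset !sub1set (bs_tl st oe) (hE (inl e)).
  by rewrite (HF j i oe) subxx.
pose P := @branching_packing V I H R0 own.
have tr i : trims_rooted (P i) t := branching_trims_rooted (H := H) st t_ends t_trim i.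
have trP : trims_packing P t.
  split=> // i j ne; rewrite -setI_eq0; apply/eqP/setP => e; rewrite !inE.
  by apply/negP => /andP[/eqP -> /eqP[eij]]; rewrite eij eqxx in ne.
have NE v : #|[set i | v \in (P i).1]| = #|R0 v| by apply: eq_card => i; rewrite !inE.
exists F, I, P; split.
- by split=> [i|]; exists t.
- exists t, (fun i => (P i).1), id; split=> //; last first.
  + move=> v; rewrite (_ : [set i | _] = U v) //; apply/setP => i.
    by rewrite in_set (branching_gverts (H := H) st t_ends) inE.
  + by exists id.
  move=> i; apply/subsetP => v; rewrite inE => /(subsetP (iR v).2).
  by rewrite mem_meeting1.
- by move=> v; rewrite NE.
by rewrite /limited sum_card_roots (_ : fsum _ _ = fsum (fun v => #|R0 v|) [set: V]) //;
  apply: eq_bigr => v _; rewrite NE.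
Qed.
End Sufficiency.

Theorem theorem15 (V : finType) (G : hypergraph V) (I : finType) (S : I -> {set V})
    (alpha beta gamma : nat) (f g : V -> nat) (M : matroid I)
    (V_nonempty : 0 < #|V|) (V_has_edges : 0 < gamma -> 1 < #|V|) :
  (exists (F : 'I_gamma -> edge V) (K : finType)
          (P : K -> {set V} * {set hedge (add_edges G F)}),
     [/\ packing P, matroid_based S M P, bounded f g P & limited alpha beta P])
  <->
  [/\ alpha <= beta,
      forall Y : {set V},
        ((rank_deficit S M Y)%:Z
           <= Num.min (beta%:Z - (fsum f Y)%:Z) (fsum g (~: Y))%:Z)%R,
      forall v : V, f v <= minn (mrank M (meeting S [set v])) (g v),
      alpha <= \sum_(v : V) minn (mrank M (meeting S [set v])) (g v)
    & (forall P : {set {set V}}, partition P [set: V] ->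
         \sum_(X in P) \max_(Y : {set V} | Y \subset X) (rank_deficit S M Y + fsum g Y)
           <= fsum g [set: V] + gamma + crossing G P)
      /\
      (forall P : {set {set V}}, partition P [set: V] ->
         \sum_(X in P) \max_(Y : {set V} | Y \subset X) (rank_deficit S M Y + fsum f Y)
           <= beta + gamma + crossing G P)].
Proof.
(* The integer difference may be negative; moving the subtracted term across gives two inequalities
   between naturals. *)
have min_le (x y z w : nat) : (x%:Z <= Num.min (y%:Z - z%:Z) w%:Z)%R = (x + z <= y) && (x <= w).
  by rewrite Order.TotalTheory.le_min; congr andb; apply/idP/idP; clear; lia.
split=> [[F [K [P [_ bas bnd lim]]]]|[ab c2 c3 c4 [c5 c6]]].
  have [ab c2 c3 c4 c56] := packing_necessary V_nonempty bas bnd lim; split=> // Y.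
  by rewrite min_le; apply/andP; apply: c2.
have c2' Y : rank_deficit S M Y + fsum f Y <= beta /\ rank_deficit S M Y <= fsum g (~: Y).
  by apply/andP; rewrite -min_le.
have fg v : f v <= g v by apply: leq_trans (c3 v) (geq_minr _ _).
have [t [d [C tb tbeta dE]]] := covering_vectors V_nonempty fg c2' c5 c6.
have [h [R0 [hE Rc iR Rb Rt]]] := oriented_roots V_nonempty ab c3 c4 C tb tbeta dE.
exact: packing_of_branching V_has_edges hE Rc iR Rb Rt.
Qed.
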